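(* Minimum $k$-Union strictly reduces to opt-plurality-CCDC, i.e., $\mathrm{M}k\mathrm{U}\le_{\rm strict}\text{opt-plurality-CCDC}$.
   Context: Minimum $k$-Union (M$k$U) is the minimization problem: an instance is $(\mathcal{U},\mathcal{S},k)$ where $\mathcal{U}=\{u_1,\dots,u_n\}$ is a nonempty finite set, $\mathcal{S}=\{S_1,\dots,S_m\}$ is a family of nonempty subsets of $\mathcal{U}$, and $k\le m$ is a natural number; a feasible solution is $\mathcal{S}'\subseteq\mathcal{S}$ with $\|\mathcal{S}'\|=k$; its measure is $\|\bigcup_{S\in\mathcal{S}'}S\|$. opt-plurality-CCDC: an instance is $(C,V,p)$ where $V$ is a multiset of linear orders over the finite set $C$ and $p\in C$; a feasible solution is $C'\subseteq C$ with $p\notin C'$ such that $p$ is the unique plurality winner of $(C-C',V)$ (votes restricted to $C-C'$; each candidate gets one point per vote ranking it first, and the unique winner is the only candidate with maximum points); the measure is $1+\|C'\|$, to be minimized. For a minimization problem $A$, $\mathrm{OPT}_A(x)$ is the minimum measure of a feasible solution of $x$ and the performance ratio of a feasible $y$ is $R_A(x,y)=\max\{\mu_A(x,y)/\mathrm{OPT}_A(x),\mathrm{OPT}_A(x)/\mu_A(x,y)\}$. $A$ strictly reduces to $B$ ($A\le_{\rm strict}B$) if there are polynomial-time computable functions $f,g$ such that for each instance $x$ of $A$, $f(x)$ is an instance of $B$, and for each feasible solution $y$ of $f(x)$, $g(x,y)$ is a feasible solution of $x$ with $R_A(x,g(x,y))\le R_B(f(x),y)$. *)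

(* Defs.v *)
From mathcomp Require Import all_boot all_order all_algebra.
Set Implicit Arguments. Unset Strict Implicit. Unset Printing Implicit Defensive.
Import Order.TTheory GRing.Theory Num.Theory.

(* Minimum k-Union.  U = {0,..,n-1}; S = list of subsets, each given  *)
(* canonically as a strictly increasing list of elements of U.        *)
Record mku_inst := MkMkU { mku_n : nat; mku_sets : seq (seq nat); mku_k : nat }.

Definition mku_valid (x : mku_inst) : bool :=
  [&& 0 < mku_n x,
      all (fun s => [&& s != [::], sorted ltn s & all (fun u => u < mku_n x) s])
          (mku_sets x),
      uniq (mku_sets x)
    & mku_k x <= size (mku_sets x)].

(* a sub-family S' is given by the list of indices of its members *)
Definition mku_feasible (x : mku_inst) (y : seq nat) : bool :=
  [&& uniq y, all (fun i => i < size (mku_sets x)) y & size y == mku_k x].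

Definition mku_measure (x : mku_inst) (y : seq nat) : nat :=
  size (undup (flatten [seq nth [::] (mku_sets x) i | i <- y])).

(* opt-plurality-CCDC.  C = {0,..,c-1}; each vote is a linear order,  *)
(* i.e. a permutation of C listed from most to least preferred.       *)
Record ccdc_inst := MkCCDC { cc_c : nat; cc_votes : seq (seq nat); cc_p : nat }.

Definition ccdc_valid (z : ccdc_inst) : bool :=
  (cc_p z < cc_c z) && all (fun v => perm_eq v (iota 0 (cc_c z))) (cc_votes z).

Definition plurality_score (V : seq (seq nat)) (C' : seq nat) (a : nat) : nat :=
  count (fun v => ohead [seq b <- v | b \notin C'] == Some a) V.

Definition unique_plurality_winner (z : ccdc_inst) (C' : seq nat) : bool :=
  all (fun a => [|| a \in C', a == cc_p z |
                 plurality_score (cc_votes z) C' a < plurality_score (cc_votes z) C' (cc_p z)])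
      (iota 0 (cc_c z)).

Definition ccdc_feasible (z : ccdc_inst) (y : seq nat) : bool :=
  [&& uniq y, all (fun a => a < cc_c z) y, cc_p z \notin y
    & unique_plurality_winner z y].

Definition ccdc_measure (z : ccdc_inst) (y : seq nat) : nat := (size y).+1.

Definition is_opt (I : Type) (feas : I -> seq nat -> bool) (mu : I -> seq nat -> nat)
  (x : I) (o : nat) : Prop :=
  (exists y, feas x y /\ mu x y = o) /\ (forall y, feas x y -> o <= mu x y).

Definition perf_ratio (mu opt : nat) : rat :=
  Num.max ((mu%:R / opt%:R)%R) ((opt%:R / mu%:R)%R).

Definition sym := option bool.  (* None = blank *)

(* delta q a = None : halt;  Some (q', b, mv) : write b, go to q',     *)
(* move right if mv = true, left otherwise.  Start state: ord0.        *)
Record TM := MkTM {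
  tm_n : nat;
  tm_delta : 'I_tm_n.+1 -> sym -> option ('I_tm_n.+1 * sym * bool) }.

Record config (M : TM) := Config {
  cst : 'I_(tm_n M).+1; clft : seq sym; ccur : sym; crgt : seq sym }.

Definition tm_step (M : TM) (k : config M) : option (config M) :=
  match tm_delta (cst k) (ccur k) with
  | None => None
  | Some (q, b, true) => Some (Config q (b :: clft k) (head None (crgt k)) (behead (crgt k)))
  | Some (q, b, false) => Some (Config q (behead (clft k)) (head None (clft k)) (b :: crgt k))
  end.

Fixpoint tm_run (M : TM) (t : nat) (k : config M) : config M :=
  match t with
  | 0 => k
  | t'.+1 => match tm_step k with Some k' => tm_run t' k' | None => k end
  end.

Definition tm_halted (M : TM) (k : config M) : bool :=
  if tm_step k is None then true else false.

Definition tm_init (M : TM) (w : seq bool) : config M :=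
  Config ord0 [::] (head None (map Some w)) (behead (map Some w)).

Definition tm_output (M : TM) (k : config M) : seq bool :=
  let s := ccur k :: crgt k in
  map (odflt false) (take (find (fun a => a == None) s) s).

Definition ptime_computable (X Y : Type) (encX : X -> seq bool) (encY : Y -> seq bool)
  (P : X -> Prop) (F : X -> Y) : Prop :=
  exists (M : TM) (c d : nat), forall x, P x ->
    exists t, t <= c * (size (encX x)) ^ d + c /\
      tm_halted (tm_run t (tm_init M (encX x))) /\
      tm_output (tm_run t (tm_init M (encX x))) = encY (F x).

Definition enc_nat (n : nat) : seq bool := rcons (nseq n true) false.
Definition enc_seq (T : Type) (e : T -> seq bool) (s : seq T) : seq bool :=
  enc_nat (size s) ++ flatten (map e s).
Definition enc_mku (x : mku_inst) : seq bool :=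
  enc_nat (mku_n x) ++ enc_seq (enc_seq enc_nat) (mku_sets x) ++ enc_nat (mku_k x).
Definition enc_ccdc (z : ccdc_inst) : seq bool :=
  enc_nat (cc_c z) ++ enc_seq (enc_seq enc_nat) (cc_votes z) ++ enc_nat (cc_p z).
Definition enc_sol (y : seq nat) : seq bool := enc_seq enc_nat y.
Definition enc_mku_sol (p : mku_inst * seq nat) : seq bool := enc_mku p.1 ++ enc_sol p.2.

Definition mku_strictly_reduces_to_ccdc : Prop :=
  exists (f : mku_inst -> ccdc_inst) (g : mku_inst -> seq nat -> seq nat),
    [/\ ptime_computable enc_mku enc_ccdc (fun x => mku_valid x) f,
        ptime_computable enc_mku_sol enc_sol
          (fun p => mku_valid p.1 /\ ccdc_feasible (f p.1) p.2) (fun p => g p.1 p.2),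
        (forall x, mku_valid x -> ccdc_valid (f x)),
        (forall x y, mku_valid x -> ccdc_feasible (f x) y -> mku_feasible x (g x y))
      & (forall x y oA oB, mku_valid x -> ccdc_feasible (f x) y ->
           is_opt mku_feasible mku_measure x oA ->
           is_opt ccdc_feasible ccdc_measure (f x) oB ->
           perf_ratio (mku_measure x (g x y)) oA
             <= perf_ratio (ccdc_measure (f x) y) oB)%R].

(* Main.v *)
(* Each vote is a short prefix followed by the other candidates in a fixed order with the
   distinguished candidate p last. A vote for each set S ranks S first and then p, so p gains a
   point exactly when S is deleted, and a rival w forces p to collect k such points. Counting 1 +
   |C'| would spoil the ratio if every element cost one deletion, so a second rival z gains m
   points from each deleted element, while deleting the partner of an element gives m points to
   both p and w: p can afford one element more than the partners deleted. Covering a union of size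
   t thus costs t + (t - 1) deletions, that is, measure 2t. Deleting both rivals does not help,
   because their votes then fall to the next remaining candidate, until everything but p is gone,
   at cost 2n + 2. The backward map lists the covered sets before the uncovered ones and keeps the
   first k.

   For polynomial time, programs on registers holding bit stacks are compiled to a Turing machine
   with one tape. Every loop of such a program pops the register that controls it and never pushes
   on it, so the running time is polynomial in a bound on the size of the registers, and only
   those sizes have to be controlled. *)
Require Import Defs.
From mathcomp Require Import all_boot all_order all_algebra.
From mathcomp Require Import zify ring.
From Stdlib Require Import FunctionalExtensionality.
Set Implicit Arguments. Unset Strict Implicit. Unset Printing Implicit Defensive.
Import GRing.Theory.

(** * Turing machines for structured tape programs *)

(** For k > 0 the two maps match measures up to the factor 2: every control set [y] yields k sets
    whose union has at most (1 + |y|)/2 elements, and k sets with a union of size t yield a control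
    set of measure at most 2t. So the optimum of the image is at most twice the optimum of the
    source, and cross-multiplication carries the ratio over without loss. The whole gadget is
    repeated in each of the m blocks because p can gain up to m points from covered sets: only steps
    of m between scores compare deleted elements with deleted partners whatever the coverage is. The
    candidates p and w start from two points per block, since a remaining element or partner can
    reach 2m points, which p exceeds thanks to its single extra vote. The rival z starts from one
    point per block, and this missing point is the one element more that p can afford. The k extra
    votes for each rival set the threshold on the covered sets, and the extra vote for p breaks the
    tie when exactly k are covered. *)

Definition tape := int -> sym.

Definition twrite (T : tape) (h : int) (a : sym) : tape :=
  fun z => if z == h then a else T z.

Lemma tm_runD (M : TM) a b (k : config M) : tm_run (a + b) k = tm_run b (tm_run a k).
Proof.
elim: a k => [|a IHa] k //=; case E: (tm_step k) => [k'|]; first exact: IHa.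
by case: (b) => //= b'; rewrite E.
Qed.

(** Cells beyond the finite lists of a configuration read as blanks through the default of [nth], so
    trailing blanks in these lists do not matter. *)
Definition on_tape (M : TM) (k : config M) (T : tape) (h : int) :=
  [/\ forall d : nat, nth None (clft k) d = T (h - 1 - d%:Z)%R,
      ccur k = T h
    & forall d : nat, nth None (crgt k) d = T (h + 1 + d%:Z)%R].

Definition tmove (h : int) (d : option bool) : int :=
  match d with Some true => h + 1 | Some false => h - 1 | None => h end%R.

Lemma on_tape_step (M : TM) (k : config M) T h q b mv :
  on_tape k T h -> tm_delta (cst k) (ccur k) = Some (q, b, mv) ->
  exists k', [/\ tm_step k = Some k', cst k' = q
    & on_tape k' (twrite T h b) (tmove h (Some mv))].
Proof.
move=> [kl kc kr] dk; rewrite /tm_step dk; case: mv {dk}; eexists; split=> //; split=> /=.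
- case=> [|d] /=; rewrite /twrite.
  + by rewrite ifT //; apply/eqP; lia.
  + by rewrite kl ifF; [congr T|apply/eqP]; lia.
- by rewrite -nth0 kr /twrite ifF; [congr T|apply/eqP]; lia.
- by move=> d; rewrite nth_behead kr /twrite ifF; [congr T|apply/eqP]; lia.
- by move=> d; rewrite nth_behead kl /twrite ifF; [congr T|apply/eqP]; lia.
- by rewrite -nth0 kl /twrite ifF; [congr T|apply/eqP]; lia.
- case=> [|d] /=; rewrite /twrite.
  + by rewrite ifT //; apply/eqP; lia.
  + by rewrite kr ifF; [congr T|apply/eqP]; lia.
Qed.

Lemma tm_output_on_tape (M : TM) (k : config M) T h w :
  on_tape k T h -> (forall d, d < size w -> T (h + d%:Z)%R = Some (nth false w d)) ->
  T (h + (size w)%:Z)%R = None -> tm_output k = w.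
Proof.
case=> _ kc kr Tw Te; rewrite /tm_output; set s := ccur k :: crgt k.
have sT d : nth None s d = T (h + d%:Z)%R.
  case: d => [|d] /=; first by rewrite kc; congr T; lia.
  by rewrite kr; congr T; lia.
have ws : size w <= size s.
  rewrite leqNgt; apply/negP => lt_sw.
  by have := Tw _ lt_sw; rewrite -sT nth_default.
have Ef : find (fun a => a == None) s = size w.
  apply/eqP; rewrite eqn_leq; apply/andP; split; last first.
    rewrite leqNgt; apply/negP => lt_f.
    have hs : has (fun a => a == None) s by rewrite has_find (leq_trans lt_f).
    have := nth_find None hs; rewrite sT Tw //.
  (* If [w] fills all of [s], the blank after it is only the default of [nth]; [find] then returns
     the size, which is still right. *)
  case: (ltngtP (size w) (size s)) ws => // [lt_ws|->] _; last exact: find_size.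
  rewrite leqNgt; apply/negP => lt_f.
  by have := before_find None lt_f; rewrite sT Te eqxx.
apply: (@eq_from_nth _ false); first by rewrite size_map size_take_min Ef; rewrite (minn_idPl ws).
rewrite size_map size_take_min Ef => i; rewrite (minn_idPl ws) => lt_i.
rewrite (nth_map None) ?size_take_min ?Ef ?(minn_idPl ws) //.
by rewrite nth_take // sT Tw.
Qed.

(** * Instruction lists with a program counter, run by a Turing machine *)

Definition instr := sym -> sym -> sym * sym * option bool * nat.
Definition astate := (nat * sym * tape * int)%type.
Definition dirc (d : option bool) : nat := if d is None then 2 else 1.

(** The premise [pc' <= size C] keeps jump targets where [inord] is exact. The address [size C], at
    which no instruction is found, is the halting one. *)
Inductive areach (C : seq instr) : astate -> astate -> nat -> Prop :=
| areach0 s : areach C s s 0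
| areachS pc r T h i pc' r' a' d s n :
    ohead (drop pc C) = Some i -> i r (T h) = (r', a', d, pc') -> pc' <= size C ->
    areach C (pc', r', twrite T h a', tmove h d) s n ->
    areach C (pc, r, T, h) s (dirc d + n).

Lemma areach_trans C s1 s2 s3 n1 n2 :
  areach C s1 s2 n1 -> areach C s2 s3 n2 -> areach C s1 s3 (n1 + n2).
Proof.
elim=> // {s1 s2 n1} pc r T h i pc' r' a' d s n Ei Ei' le_pc' _ IH H; rewrite -addnA.
by apply: areachS Ei Ei' le_pc' _; apply: IH.
Qed.

(* The flag of a control state is set on the way back of a stay move, which is performed as a step
   to the right followed by one to the left. *)
Section CodeTM.
Variable C : seq instr.

Definition cstate : finType := ('I_(size C).+1 * sym * bool)%type.
Definition cstate0 : cstate := (ord0, None, false).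

Definition cdelta (q : cstate) (a : sym) : option (cstate * sym * bool) :=
  let: (pc, r, back) := q in
  if back then Some ((pc, r, false), a, false) else
  if ohead (drop pc C) is Some i then
    let: (r', a', d, pc') := i r a in
    if d is Some mv then Some ((inord pc', r', false), a', mv)
    else Some ((inord pc', r', true), a', true)
  else None.

Definition cdec (s : 'I_(#|cstate|.+1)) : cstate :=
  if unlift ord0 s is Some i then enum_val i else cstate0.
Definition cenc (q : cstate) : 'I_(#|cstate|.+1) := lift ord0 (enum_rank q).

Lemma cencK : cancel cenc cdec.
Proof. by move=> q; rewrite /cdec /cenc liftK enum_rankK. Qed.

(* State [ord0] duplicates [cstate0], which saves making [enum_rank] send the start state to
   [ord0]. *)
Definition code_tm : TM :=
  @MkTM #|cstate| (fun s a =>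
    omap (fun x : cstate * sym * bool => (cenc x.1.1, x.1.2, x.2)) (cdelta (cdec s) a)).

Definition at_state (k : config code_tm) (s : astate) :=
  let: (pc, r, T, h) := s in cdec (cst k) = (inord pc, r, false) /\ on_tape k T h.

Lemma areach_tm s s' n (k : config code_tm) : areach C s s' n -> at_state k s ->
  at_state (tm_run n k) s'.
Proof.
move=> H; elim: H k => // {s s' n} pc r T h i pc' r' a' d s n Ei Ei' le_pc' _ IH k [ck kT].
have lt_pc : pc < (size C).+1.
  by rewrite ltnS leqNgt; apply/negP=> lt; rewrite drop_oversize // ltnW in Ei.
have [_ kc _] := kT.
rewrite tm_runD; apply: IH.
case: d Ei' => [mv|] Ei' /=.
  have dk : tm_delta (cst k) (ccur k) = Some (cenc (inord pc', r', false), a', mv).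
    by rewrite /= ck kc /cdelta inordK // Ei Ei'.
  have [k' [-> ck' kT']] := on_tape_step kT dk.
  by rewrite /at_state ck' cencK.
have dk : tm_delta (cst k) (ccur k) = Some (cenc (inord pc', r', true), a', true).
  by rewrite /= ck kc /cdelta inordK // Ei Ei'.
have [k' [-> ck' kT']] := on_tape_step kT dk.
have dk' : tm_delta (cst k') (ccur k') = Some (cenc (inord pc', r', false), ccur k', false).
  by rewrite /= ck' cencK.
have [k2 [-> ck2 [kT1 kT2 kT3]]] := on_tape_step kT' dk'.
rewrite /at_state ck2 cencK; split=> //; case: kT' => _ kc' _.
have Eh : tmove (tmove h (Some true)) (Some false) = h by rewrite /=; lia.
(* The return step of a stay move follows a step that writes back the symbol it has read, so only
   the first write changes the tape. *)
have Ew z : twrite (twrite T h a') (tmove h (Some true)) (ccur k') z = twrite T h a' z.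
  by rewrite kc' {1}/twrite; case: eqP => [->|].
by split=> [d||d]; rewrite ?kT1 ?kT2 ?kT3 Ew Eh.
Qed.

Lemma halted_code_tm r T h (k : config code_tm) :
  at_state k (size C, r, T, h) -> tm_halted k.
Proof.
by move=> [ck kT]; rewrite /tm_halted /tm_step /= ck /cdelta inordK // drop_size.
Qed.

(** The input ends in cell -1, where the layout of register 0 wants it. The machine cannot tell
    absolute positions, so the origin may be chosen behind the input. *)
Definition init_tape (w : seq bool) : tape :=
  fun z => if (z < 0)%R then nth None (map Some (rev w)) (`|z|%N).-1 else None.

Lemma init_tapeE w (i : nat) : init_tape w (i%:Z - (size w)%:Z)%R = nth None (map Some w) i.
Proof.
rewrite /init_tape; case: ifP => le_i; case: (ltnP i (size w)) => lt_i; try lia.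
- by rewrite !(nth_map false) ?size_rev ?nth_rev; try lia; congr (Some (nth _ _ _)); lia.
- by rewrite nth_default // size_map.
Qed.

Lemma at_state_init w :
  at_state (tm_init code_tm w) (0, None, init_tape w, - (size w)%:Z)%R.
Proof.
split; first by rewrite /= /cdec unlift_none /cstate0; do 2!congr pair; apply: val_inj; rewrite /=
    inordK.
split=> [d||d].
- rewrite [clft _]/= nth_nil /init_tape; case: ifP => // _.
  by rewrite nth_default // size_map size_rev; lia.
- by have := init_tapeE w 0; rewrite add0r => ->; case: w.
- rewrite [crgt _]/= nth_behead -init_tapeE; congr init_tape; lia.
Qed.

End CodeTM.

(** * Structured tape programs and their compilation *)

Inductive tprog :=
| TAct of (sym -> sym -> sym * sym * option bool)
| TSeq of tprog & tprog
| TIf of (sym -> sym -> bool) & tprog & tprog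
| TWhile of (sym -> sym -> bool) & tprog.

Definition tstate := (sym * tape * int)%type.

(** Each constant 2 is a branch or a jump of the compiled code, a stay move that takes two machine
    steps; the count is thus exact. *)
Inductive texec : tprog -> tstate -> tstate -> nat -> Prop :=
| texec_act f r T h r' a' d : f r (T h) = (r', a', d) ->
    texec (TAct f) (r, T, h) (r', twrite T h a', tmove h d) (dirc d)
| texec_seq p q s1 s2 s3 n1 n2 : texec p s1 s2 n1 -> texec q s2 s3 n2 ->
    texec (TSeq p q) s1 s3 (n1 + n2)
| texec_if_true (c : sym -> sym -> bool) p q r T h s n : c r (T h) -> texec p (r, T, h) s n ->
    texec (TIf c p q) (r, T, h) s (2 + (n + 2))
| texec_if_false (c : sym -> sym -> bool) p q r T h s n : ~~ c r (T h) -> texec q (r, T, h) s n ->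
    texec (TIf c p q) (r, T, h) s (2 + n)
| texec_while_stop (c : sym -> sym -> bool) p r T h : ~~ c r (T h) -> texec (TWhile c p) (r, T, h)
    (r, T, h) 2
| texec_while_step (c : sym -> sym -> bool) p r T h s2 s3 n1 n2 : c r (T h) -> texec p (r, T, h) s2
    n1 ->
    texec (TWhile c p) s2 s3 n2 -> texec (TWhile c p) (r, T, h) s3 (2 + (n1 + (2 + n2))).

Definition ibranch (c : sym -> sym -> bool) l1 l2 : instr :=
  fun r a => (r, a, None, if c r a then l1 else l2).
Definition ijump l : instr := ibranch (fun _ _ => true) l l.

(** Jump targets are absolute, so [pc] is the address at which the code will be placed. *)
Fixpoint tcomp (p : tprog) (pc : nat) : seq instr :=
  match p with
  | TAct f => [:: fun r a => let: (r', a', d) := f r a in (r', a', d, pc.+1)]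
  | TSeq p q => let P := tcomp p pc in P ++ tcomp q (pc + size P)
  | TIf c p q =>
      let P := tcomp p pc.+1 in let Q := tcomp q (pc + size P).+2 in
      ibranch c pc.+1 (pc + size P).+2 :: P ++ ijump (pc + size P + size Q).+2 :: Q
  | TWhile c p =>
      let P := tcomp p pc.+1 in
      ibranch c pc.+1 (pc + size P).+2 :: P ++ [:: ijump pc]
  end.

Lemma ibranch_reach C C1 C2 c l1 l2 pc r T h : C = C1 ++ ibranch c l1 l2 :: C2 ->
  pc = size C1 -> (if c r (T h) then l1 else l2) <= size C ->
  areach C (pc, r, T, h) (if c r (T h) then l1 else l2, r, T, h) 2.
Proof.
move=> EC -> le_l; have Ew : T = twrite T h (T h).
  by apply: functional_extensionality => z; rewrite /twrite; case: eqP => [->|].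
have := areachS (C := C) (pc := size C1) (r := r) (T := T) (h := h) (d := None).
rewrite {1}EC drop_size_cat // => /(_ _ _ _ _ _ 0 erefl erefl le_l) /=.
by rewrite -Ew; apply; apply: areach0.
Qed.

Definition tput (pc : nat) (s : tstate) : astate := (pc, s.1.1, s.1.2, s.2).

(** The induction is on the run, because a loop unfolds to itself. The surrounding code [C1], [C2]
    is general because subprograms do not start at address 0. *)
Lemma tcomp_reach p s s' n : texec p s s' n -> forall C1 C2 C, 
  C = C1 ++ tcomp p (size C1) ++ C2 ->
  areach C (tput (size C1) s) (tput (size C1 + size (tcomp p (size C1))) s') n.
Proof.
elim=> {p s s' n}.
- move=> f r T h r' a' d Ef C1 C2 C ->; rewrite /tput /= addn1 -[dirc d]addn0.
  apply: (areachS (d := d)); first by rewrite drop_size_cat.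
  + by rewrite /= Ef.
  + by rewrite size_cat /=; lia.
  + exact: areach0.
- move=> p q s1 s2 s3 n1 n2 _ IHp _ IHq C1 C2 C EC /=.
  rewrite size_cat addnA; set P := tcomp p (size C1) in EC *; apply: areach_trans.
    by apply: (IHp C1 (tcomp q (size C1 + size P) ++ C2)); rewrite EC /= -/P !catA.
  rewrite -[size C1 + size P]size_cat.
  by apply: (IHq (C1 ++ P) C2); rewrite EC /= -/P -!catA size_cat.
- move=> c p q r T h s n Ec _ IHp C1 C2 C EC; set P := tcomp p (size C1).+1.
  set Q := tcomp q (size C1 + size P).+2.
  have {}EC : C = C1 ++ ibranch c (size C1).+1 (size C1 + size P).+2 :: (P ++
    ijump (size C1 + size P + size Q).+2 :: Q) ++ C2 by rewrite EC.
  have sC : size C = (size C1 + (size P + size Q + size C2)).+2.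
    by rewrite EC; do !rewrite size_cat /=; lia.
  apply: areach_trans.
    by have := ibranch_reach (r := r) (T := T) (h := h) EC erefl; rewrite Ec sC; apply; lia.
  apply: areach_trans.
    have := IHp (rcons C1 (ibranch c (size C1).+1 (size C1 + size P).+2))
      (ijump (size C1 + size P + size Q).+2 :: Q ++ C2) C.
    by rewrite size_rcons -/P /tput; apply; rewrite EC cat_rcons /= -?catA.
  have EC2 : C = (C1 ++ ibranch c (size C1).+1 (size C1 + size P).+2 :: P) ++
      ijump (size C1 + size P + size Q).+2 :: Q ++ C2 by rewrite EC -?catA /= -?catA.
  have := ibranch_reach (r := s.1.1) (T := s.1.2) (h := s.2) EC2.
  rewrite /tput /= -/P -/Q size_cat /= sC => /(_ _ erefl) H.
  rewrite (_ : (size C1).+1 + size P = size C1 + (size P).+1); last by lia.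
  rewrite (_ : size C1 + (size (P ++ ijump _ :: Q)).+1 = (size C1 + size P + size Q).+2).
    by apply: H; lia.
  by rewrite size_cat /=; lia.
- move=> c p q r T h s n Ec _ IHq C1 C2 C EC; set P := tcomp p (size C1).+1.
  set Q := tcomp q (size C1 + size P).+2.
  have {}EC : C = C1 ++ ibranch c (size C1).+1 (size C1 + size P).+2 :: (P ++
    ijump (size C1 + size P + size Q).+2 :: Q) ++ C2 by rewrite EC.
  have sC : size C = (size C1 + (size P + size Q + size C2)).+2.
    by rewrite EC; do !rewrite size_cat /=; lia.
  apply: areach_trans.
    by have := ibranch_reach (r := r) (T := T) (h := h) EC erefl; rewrite (negbTE Ec) sC; apply; lia.
  have := IHq (C1 ++ ibranch c (size C1).+1 (size C1 + size P).+2 :: P ++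
    [:: ijump (size C1 + size P + size Q).+2]) C2 C.
  rewrite size_cat /= size_cat /= -/P -/Q size_cat /=.
  have -> : size C1 + (size P + 1).+1 = (size C1 + size P).+2 by lia.
  have -> : size C1 + (size P + (size Q).+1).+1 = (size C1 + size P).+2 + size Q by lia.
  apply; rewrite EC -?catA /= -?catA //.
- move=> c p r T h Ec C1 C2 C EC; set P := tcomp p (size C1).+1.
  have {}EC : C = C1 ++ ibranch c (size C1).+1 (size C1 + size P).+2 :: (P ++
    [:: ijump (size C1)]) ++ C2 by rewrite EC.
  have := ibranch_reach (r := r) (T := T) (h := h) EC erefl.
  rewrite (negbTE Ec) /tput /= -/P size_cat /= addn1 !addnS; apply.
  by rewrite EC; do !rewrite size_cat /=; lia.
- move=> c p r T h s2 s3 n1 n2 Ec _ IHp _ IHw C1 C2 C EC; set P := tcomp p (size C1).+1.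
  have EC0 := EC.
  have {}EC : C = C1 ++ ibranch c (size C1).+1 (size C1 + size P).+2 :: (P ++
    [:: ijump (size C1)]) ++ C2 by rewrite EC.
  have sC : size C = (size C1 + (size P + size C2)).+2.
    by rewrite EC; do !rewrite size_cat /=; lia.
  apply: areach_trans.
    by have := ibranch_reach (r := r) (T := T) (h := h) EC erefl; rewrite Ec sC; apply; lia.
  apply: areach_trans.
    have := IHp (rcons C1 (ibranch c (size C1).+1 (size C1 + size P).+2))
      (ijump (size C1) :: C2) C.
    by rewrite size_rcons -/P /tput; apply; rewrite EC cat_rcons /= -?catA.
  apply: areach_trans; last exact: (IHw C1 C2).
  have EC2 : C = (C1 ++ ibranch c (size C1).+1 (size C1 + size P).+2 :: P) ++
      ijump (size C1) :: C2 by rewrite EC -?catA /= -?catA.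
  have := ibranch_reach (r := s2.1.1) (T := s2.1.2) (h := s2.2) EC2.
  rewrite /tput /= -/P size_cat /= sC => /(_ _ erefl) H.
  by rewrite (_ : (size C1).+1 + size P = size C1 + (size P).+1); [apply: H|]; lia.
Qed.

Lemma twrite_id T h : twrite T h (T h) = T.
Proof. by apply: functional_extensionality => z; rewrite /twrite; case: eqP => [->|]. Qed.

Definition trun (p : tprog) (s s' : tstate) (b : nat) : Prop :=
  exists2 n, texec p s s' n & n <= b.

Lemma trun_leq p s s' b b' : trun p s s' b -> b <= b' -> trun p s s' b'.
Proof. by case=> n ? nb bb; exists n => //; apply: leq_trans bb. Qed.

Lemma trun_seq p q s1 s2 s3 b1 b2 :
  trun p s1 s2 b1 -> trun q s2 s3 b2 -> trun (TSeq p q) s1 s3 (b1 + b2).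
Proof.
move=> [n1 H1 l1] [n2 H2 l2]; exists (n1 + n2); last exact: leq_add.
exact: texec_seq H1 H2.
Qed.

Lemma trun_act f r T h r' a' d : f r (T h) = (r', a', d) ->
  trun (TAct f) (r, T, h) (r', twrite T h a', tmove h d) 2.
Proof. by move=> Ef; exists (dirc d); [apply: texec_act|case: d {Ef}]. Qed.

Lemma trun_at h' p r T h s b : h = h' -> trun p (r, T, h') s b -> trun p (r, T, h) s b.
Proof. by move=> ->. Qed.

Lemma trun_to h' p s r T h b : h = h' -> trun p s (r, T, h') b -> trun p s (r, T, h) b.
Proof. by move=> ->. Qed.

Lemma trun_act_id f r T h r' d : f r (T h) = (r', T h, d) ->
  trun (TAct f) (r, T, h) (r', T, tmove h d) 2.
Proof.
by move=> Ef; rewrite -[X in trun _ _ (_, X, _) _](twrite_id T h); apply: trun_act.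
Qed.

Lemma trun_if (c : sym -> sym -> bool) p q r T h s b :
  trun (if c r (T h) then p else q) (r, T, h) s b -> trun (TIf c p q) (r, T, h) s (b + 4).
Proof.
case E: (c r (T h)) => -[n H nb].
  by exists (2 + (n + 2)); [apply: texec_if_true; rewrite ?E|lia].
by exists (2 + n); [apply: texec_if_false; rewrite ?E|lia].
Qed.

Lemma trun_while_stop (c : sym -> sym -> bool) p r T h : ~~ c r (T h) ->
  trun (TWhile c p) (r, T, h) (r, T, h) 2.
Proof. by move=> E; exists 2 => //; apply: texec_while_stop. Qed.

Lemma trun_while_step (c : sym -> sym -> bool) p r T h s2 s3 b1 b2 : c r (T h) ->
  trun p (r, T, h) s2 b1 -> trun (TWhile c p) s2 s3 b2 ->
  trun (TWhile c p) (r, T, h) s3 (b1 + b2 + 4).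
Proof.
move=> E [n1 H1 l1] [n2 H2 l2]; exists (2 + (n1 + (2 + n2))); last lia.
exact: texec_while_step H1 H2.
Qed.

Definition tskip := TAct (fun r a => (r, a, None)).
Definition tgo (mv : bool) := TAct (fun r a => (r, a, Some mv)).
Definition tmoves (mv : bool) (n : nat) := iter n (TSeq (tgo mv)) tskip.

Arguments tmoves : simpl never.

Definition toward (mv : bool) (n : nat) : int := (if mv then n%:Z else - n%:Z)%R.

Lemma trun_skip r T h : trun tskip (r, T, h) (r, T, h) 2.
Proof. exact: (trun_act_id (d := None)). Qed.

Lemma trun_moves mv n r T h :
  trun (tmoves mv n) (r, T, h) (r, T, h + toward mv n)%R (n.*2 + 2).
Proof.
rewrite /tmoves; elim: n h => [|n IHn] h /=.
  by rewrite (_ : h + toward mv 0 = h)%R; [exact: trun_skip|case: mv => /=; lia].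
rewrite (_ : n.+1.*2 + 2 = 2 + (n.*2 + 2)); last lia.
have H := IHn (tmove h (Some mv)); move: H.
rewrite (_ : tmove h (Some mv) + toward mv n = h + toward mv n.+1)%R; last first.
  by case: mv {IHn} => /=; lia.
move=> H; apply: trun_seq H.
exact: trun_act_id.
Qed.

Definition nonblank (r a : sym) := a != None.

(** The stride is general: it is [R] cells when the head returns along the markers and one cell
    along register 0. *)
Lemma trun_walk p (delta : int) c s r T h :
  (forall r T h, trun p (r, T, h) (r, T, h + delta)%R c) ->
  (forall d : nat, d < s -> T (h + d%:Z * delta)%R != None) ->
  T (h + s%:Z * delta)%R = None ->
  trun (TWhile nonblank p) (r, T, h) (r, T, h + s%:Z * delta)%R (s * (c + 4) + 2).
Proof.
move=> Hp; elim: s h => [|s IHs] h Ts Te.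
  rewrite mul0r addr0 in Te *; apply: trun_while_stop.
  by rewrite /nonblank Te.
have Eh d : (h + delta + d%:Z * delta = h + d.+1%:Z * delta)%R by rewrite intS; ring.
rewrite (_ : s.+1 * (c + 4) + 2 = c + (s * (c + 4) + 2) + 4); last lia.
apply: trun_while_step (Hp _ _ _) _.
  by have := Ts 0 isT; rewrite mul0r addr0.
rewrite -Eh; apply: IHs => [d lt_d|]; rewrite Eh //.
exact: Ts.
Qed.

(** * Stacks on the tape: interleaved columns and the stack left of the origin *)

Section StackOps.
Variable R : nat.

Definition pos (i j : nat) : int := (i * R + j)%:Z.

Lemma pos_eq i j i' j' : j < R -> j' < R -> (pos i j == pos i' j') = (i == i') && (j == j').
Proof.
move=> jR j'R; rewrite /pos eqz_nat; apply/eqP/andP => [E|[/eqP-> /eqP->]] //.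
have R0 : 0 < R by lia.
have : (i * R + j) %/ R = (i' * R + j') %/ R by rewrite E.
rewrite !divnMDl // !divn_small // !addn0 => Ei; rewrite Ei eqxx.
by move: E; rewrite Ei => /addnI->.
Qed.

Lemma twrite_pos T i j i' j' a : j < R -> j' < R ->
  twrite T (pos i j) a (pos i' j') = if (i' == i) && (j' == j) then a else T (pos i' j').
Proof. by move=> jR j'R; rewrite /twrite pos_eq. Qed.

Lemma twrite_neg T i j (d : nat) a :
  twrite T (pos i j) a (- 1 - d%:Z)%R = T (- 1 - d%:Z)%R.
Proof. by rewrite /twrite ifF //; apply/negP; rewrite /pos; lia. Qed.

Section Column.
Variable j : nat.
Hypotheses (j0 : 0 < j) (jR : j < R).

Let R0 : 0 < R. Proof. lia. Qed.

(* Entering a new block always marks it, so that the way back finds all its markers set. *)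
Definition next_block (first : sym -> sym -> sym * sym * option bool) :=
  TSeq (TAct first) (TSeq (tmoves true (R - j.+1))
    (TSeq (TAct (fun r _ => (r, Some true, Some true))) (tmoves true j.-1))).

Lemma trun_next_block first r T i r' a' : first r (T (pos i j)) = (r', a', Some true) ->
  trun (next_block first) (r, T, pos i j)
    (r', twrite (twrite T (pos i j) a') (pos i.+1 0) (Some true), pos i.+1 j) (R.*2 + 4).
Proof.
move=> Ef; have -> : R.*2 + 4 = 2 + ((R - j.+1).*2 + 2 + (2 + (j.-1.*2 + 2))) by lia.
apply: trun_seq (trun_act Ef) _; apply: trun_seq (trun_moves _ _ _ _ _) _.
apply: (trun_at (h' := pos i.+1 0)); first by rewrite /pos /= mulSn; lia.
apply: trun_seq; first exact: trun_act.
rewrite [X in trun _ _ (_, _, X) _](_ : _ = tmove (pos i.+1 0) (Some true) + toward true j.-1)%R;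
    last first.
  by rewrite /pos /=; lia.
exact: trun_moves.
Qed.

Definition column (T : tape) (i : nat) (s : seq bool) :=
  forall d, T (pos (i + d) j) = nth None (map Some s) d.

Definition marked (T : tape) (i n : nat) :=
  forall d, d < n -> T (pos (i + d).+1 0) = Some true.

(** Nothing is said of column [j] from block [i] on, which the operation rewrites, nor of the later
    markers, which it may set. *)
Definition frame (T T' : tape) (i : nat) :=
  [/\ forall d : nat, T' (- 1 - d%:Z)%R = T (- 1 - d%:Z)%R,
      forall i', i' <= i -> T' (pos i' 0) = T (pos i' 0),
      forall i', i' < i -> T' (pos i' j) = T (pos i' j)
    & forall i' j', 0 < j' < R -> j' != j -> T' (pos i' j') = T (pos i' j')].

(** The top of a column is in block 0, so a push shifts the whole column by one block; the state
    carries the displaced entry. The loop stops at the first blank, and its caller writes the last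
    carried entry there. *)
Definition shift_loop := TWhile nonblank (next_block (fun r a => (a, r, Some true))).

Lemma trun_shift_loop s i b T : column T i s ->
  exists b' T', [/\ trun shift_loop (Some b, T, pos i j) (Some b', T', pos (i + size s) j)
        (size s * (R.*2 + 8) + 2),
      column (twrite T' (pos (i + size s) j) (Some b')) i (b :: s),
      marked T' i (size s) & frame T T' i].
Proof.
elim: s i b T => [|a s IHs] i b T Ts.
  have T0 d : T (pos (i + d) j) = None by rewrite Ts nth_nil.
  exists b, T; rewrite addn0; split=> //.
    by apply: trun_while_stop; rewrite /nonblank -[i]addn0 T0.
  move=> d; rewrite twrite_pos // eqxx andbT T0; case: eqP => [/eqP|].
    by rewrite -{2}[i]addn0 eqn_add2l => /eqP->.
  by case: d => [|d]; rewrite ?addn0 //= nth_nil.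
have Ta : T (pos i j) = Some a by rewrite -[i]addn0 Ts.
set T1 := twrite (twrite T (pos i j) (Some b)) (pos i.+1 0) (Some true).
have T1s : column T1 i.+1 s.
  move=> d; rewrite /T1 !twrite_pos // eqxx andbT ifF; last by lia.
  by rewrite ifF ?addSnnS ?Ts //; lia.
have [b' [T' [H1 H2 H3 [F1 F2 F3 F4]]]] := IHs i.+1 a T1 T1s.
exists b', T'; rewrite /= -addSnnS; split=> //.
- apply: (trun_leq (b := R.*2 + 4 + (size s * (R.*2 + 8) + 2) + 4)); last by rewrite mulSn; lia.
  apply: trun_while_step; last exact: H1; first by rewrite /nonblank Ta.
  by apply: trun_next_block; rewrite Ta.
- case=> [|d]; last by rewrite -addSnnS H2.
  rewrite addn0 twrite_pos // ifF; last by lia.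
  rewrite F3 // /T1 !twrite_pos // eqxx /= ifF ?eqxx //; lia.
- case=> [|d] lt_d; last by rewrite -addSnnS; apply: H3.
  by rewrite addn0 F2 // /T1 twrite_pos // !eqxx.
- split=> [d|i' le_i|i' lt_i|i' j' j'R nj].
  + by rewrite F1 /T1 !twrite_neg.
  + rewrite F2; last lia.
    by rewrite /T1 !twrite_pos // ifF ?ifF //; lia.
  + rewrite F3; last lia.
    by rewrite /T1 !twrite_pos // ifF ?ifF //; lia.
  + rewrite F4 // /T1 !twrite_pos ?ifF ?ifF //; lia.
Qed.

Lemma trun_back i r T : marked T 0 i -> T (pos 0 0) = None ->
  trun (TWhile nonblank (tmoves false R)) (r, T, pos i 0) (r, T, pos 0 0) (i * (R.*2 + 6) + 2).
Proof.
move=> Ti T0.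
have Ep d : d <= i -> (pos i 0 + d%:Z * toward false R = pos (i - d) 0)%R.
  move=> le_d; have {1}-> : i = (i - d) + d by lia.
  by rewrite /pos /= !addn0 mulnDl !PoszD !PoszM; ring.
rewrite (_ : pos 0 0 = pos i 0 + i%:Z * toward false R)%R; last by rewrite Ep // subnn.
rewrite (_ : R.*2 + 6 = R.*2 + 2 + 4); last lia.
apply: trun_walk => [*|d lt_d|]; first exact: trun_moves.
  rewrite Ep; last lia.
  by rewrite (_ : i - d = (0 + (i - d).-1).+1) ?Ti //; lia.
by rewrite Ep // subnn.
Qed.

Definition push_column (b : bool) :=
  TSeq (TAct (fun _ a => (Some b, a, Some true)))
  (TSeq (tmoves true j.-1) (TSeq shift_loop
  (TSeq (TAct (fun r _ => (r, r, Some false)))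
  (TSeq (tmoves false j.-1) (TWhile nonblank (tmoves false R)))))).

Lemma trun_push_column b s r T : T (pos 0 0) = None -> column T 0 s ->
  exists r' T', [/\ trun (push_column b) (r, T, pos 0 0) (r', T', pos 0 0)
      ((size s).+1 * (R * 6 + 30)), column T' 0 (b :: s) & frame T T' 0].
Proof.
move=> T0 Ts; have [b' [T' [H1 H2 H3 [F1 F2 F3 F4]]]] := trun_shift_loop b Ts.
exists (Some b'), (twrite T' (pos (size s) j) (Some b')); split=> //; last first.
  split=> [d|i' le_i|//|i' j' j'R nj].
  + by rewrite twrite_neg F1.
  + by rewrite twrite_pos // F2 // ifF //; lia.
  + by rewrite twrite_pos ?F4 // ?ifF //; lia.
apply: (trun_leq (b := 2 + (j.-1.*2 + 2 + (size s * (R.*2 + 8) + 2 +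
   (2 + (j.-1.*2 + 2 + (size s * (R.*2 + 6) + 2))))))); last by nia.
apply: trun_seq; first exact: trun_act.
rewrite twrite_id; apply: trun_seq (trun_moves _ _ _ _ _) _.
apply: (trun_at (h' := pos 0 j)); first by rewrite /pos /=; lia.
apply: trun_seq H1 _; apply: trun_seq; first exact: trun_act.
apply: trun_seq (trun_moves _ _ _ _ _) _.
apply: (trun_at (h' := pos (size s) 0)); first by rewrite /pos /=; lia.
apply: trun_back => [d lt_d|].
  by rewrite twrite_pos // H3 // ifF //; lia.
by rewrite twrite_pos // ifF ?F2 //; lia.
Qed.

Definition walk_loop := TWhile nonblank (next_block (fun r a => (r, a, Some true))).

Lemma trun_walk_loop s i r T : column T i s ->
  exists T', [/\ trun walk_loop (r, T, pos i j) (r, T', pos (i + size s) j)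
        (size s * (R.*2 + 8) + 2),
      column T' i s, marked T' i (size s) & frame T T' i].
Proof.
elim: s i T => [|a s IHs] i T Ts.
  exists T; rewrite addn0; split=> //.
  by apply: trun_while_stop; rewrite /nonblank -[i]addn0 Ts nth_nil.
have Ta : T (pos i j) = Some a by rewrite -[i]addn0 Ts.
set T1 := twrite T (pos i.+1 0) (Some true).
have T1s : column T1 i.+1 s.
  by move=> d; rewrite /T1 !twrite_pos // ifF ?addSnnS ?Ts //; lia.
have [T' [H1 H2 H3 [F1 F2 F3 F4]]] := IHs i.+1 T1 T1s.
exists T'; rewrite /= -addSnnS; split=> //.
- apply: (trun_leq (b := R.*2 + 4 + (size s * (R.*2 + 8) + 2) + 4)); last by rewrite mulSn; lia.
  apply: trun_while_step; last exact: H1; first by rewrite /nonblank Ta.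
  by rewrite /T1 -{2}(twrite_id T (pos i j)); apply: trun_next_block.
- case=> [|d]; last by rewrite -addSnnS H2.
  by rewrite addn0 F3 // /T1 !twrite_pos // ifF //; lia.
- case=> [|d] lt_d; last by rewrite -addSnnS; apply: H3.
  by rewrite addn0 F2 // /T1 twrite_pos // !eqxx.
- split=> [d|i' le_i|i' lt_i|i' j' j'R nj].
  + by rewrite F1 /T1 !twrite_neg.
  + rewrite F2; last lia.
    by rewrite /T1 !twrite_pos // ifF //; lia.
  + rewrite F3; last lia.
    by rewrite /T1 !twrite_pos // ifF //; lia.
  + by rewrite F4 // /T1 !twrite_pos ?ifF //; lia.
Qed.

Definition unshift_loop := TWhile nonblank
  (TSeq (tmoves false (R - j)) (TSeq (TAct (fun r a => (a, r, Some false))) (tmoves false j.-1))).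

(** The induction is from the far end, where the loop starts. Each entry is swapped with the carried
    symbol and so moves one block toward the origin: the initial carry becomes the last entry, and
    the top ends in the state. *)
Lemma trun_unshift_loop (t : seq sym) r T : T (pos 0 0) = None -> marked T 0 (size t) ->
  (forall d, d < size t -> T (pos d j) = nth None t d) ->
  exists T', [/\ trun unshift_loop (r, T, pos (size t) 0) (head None (rcons t r), T', pos 0 0)
        (size t * (R.*2 + 10) + 2),
      forall d, d < size t -> T' (pos d j) = nth None (behead (rcons t r)) d,
      forall d, size t <= d -> T' (pos d j) = T (pos d j) & frame T T' 0].
Proof.
elim/last_ind: t r T => [|t x IHt] r T T0 Tm Tt.
  by exists T; split=> //; apply: trun_while_stop; rewrite /nonblank T0.
rewrite size_rcons in Tm Tt *; set T1 := twrite T (pos (size t) j) r.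
have Tx : T (pos (size t) j) = x by rewrite Tt // nth_rcons ltnn eqxx.
have [||d lt_d|T' [H1 H2 H3 [F1 F2 F3 F4]]] := IHt x T1.
- by rewrite /T1 twrite_pos // ifF //; lia.
- by move=> d lt_d; rewrite /T1 twrite_pos // ifF ?Tm //; lia.
- rewrite /T1 twrite_pos // ifF; last lia.
  by rewrite Tt ?nth_rcons ?lt_d //; lia.
have Eb : behead (rcons (rcons t x) r) = rcons (behead (rcons t x)) r by case: (t).
exists T'; split=> //.
- apply: (trun_leq (b := ((R - j).*2 + 2 + (2 + (j.-1.*2 + 2))) +
    (size t * (R.*2 + 10) + 2) + 4)); last by rewrite mulSn; lia.
  apply: trun_while_step.
  + by rewrite /nonblank -[size t]add0n Tm.
  + apply: trun_seq (trun_moves _ _ _ _ _) _.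
    apply: (trun_at (h' := pos (size t) j)); first by rewrite /pos /= mulSn; lia.
    apply: trun_seq; first exact: trun_act.
    exact: trun_moves.
  + apply: (trun_at (h' := pos (size t) 0)); first by rewrite /pos /=; lia.
    by rewrite Tx (_ : head _ _ = head None (rcons t x)) //; case: (t).
- move=> d; rewrite ltnS leq_eqVlt => /orP[/eqP->|lt_d].
    rewrite H3 // /T1 twrite_pos // !eqxx /=.
    by rewrite Eb nth_rcons size_behead size_rcons ltnn eqxx.
  by rewrite H2 // Eb nth_rcons size_behead size_rcons lt_d.
- by move=> d lt_d; rewrite H3 ?/T1 ?twrite_pos // ?ifF //; lia.
- split=> [d|i' le_i|//|i' j' j'R nj].
  + by rewrite F1 /T1 twrite_neg.
  + by rewrite F2 // /T1 twrite_pos // ifF //; lia.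
  + by rewrite F4 // /T1 twrite_pos ?ifF //; lia.
Qed.

Definition pop_column :=
  TSeq (TAct (fun r a => (r, a, Some true)))
  (TSeq (tmoves true j.-1) (TSeq walk_loop
  (TSeq (TAct (fun _ a => (None, a, Some false)))
  (TSeq (tmoves false j.-1) unshift_loop)))).

(** The outward walk changes no entry; it finds the end of the column and sets the markers for the
    way back. On an empty column neither loop makes a round, and the blank put into the state
    reports emptiness. *)
Lemma trun_pop_column s r T : T (pos 0 0) = None -> column T 0 s ->
  exists T', [/\ trun pop_column (r, T, pos 0 0) (ohead s, T', pos 0 0)
      ((size s).+1 * (R * 6 + 30)), column T' 0 (behead s) & frame T T' 0].
Proof.
move=> T0 Ts; have [T1 [H1 H2 H3 [F1 F2 F3 F4]]] := trun_walk_loop r Ts.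
have [|||T' [G1 G2 G3 [E1 E2 E3 E4]]] := @trun_unshift_loop (map Some s) None T1.
- by rewrite F2.
- by rewrite size_map.
- by move=> d _; rewrite -H2.
rewrite size_map in G1 G2 G3.
exists T'; split.
- apply: (trun_leq (b := 2 + (j.-1.*2 + 2 + (size s * (R.*2 + 8) + 2 +
   (2 + (j.-1.*2 + 2 + (size s * (R.*2 + 10) + 2))))))); last by nia.
  apply: trun_seq; first exact: trun_act.
  rewrite twrite_id; apply: trun_seq (trun_moves _ _ _ _ _) _.
  apply: (trun_at (h' := pos 0 j)); first by rewrite /pos /=; lia.
  apply: trun_seq H1 _; apply: trun_seq; first exact: trun_act.
  rewrite twrite_id; apply: trun_seq (trun_moves _ _ _ _ _) _.
  apply: (trun_at (h' := pos (size s) 0)); first by rewrite /pos /=; lia.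
  by move: G1; case: (s).
- move=> d; case: (ltnP d (size s)) => lt_d.
    rewrite G2 //; case: (s) lt_d => //= a s' lt_d.
    rewrite nth_rcons size_map; case: ltnP => // le_d.
    by rewrite [RHS]nth_default ?size_map // if_same.
  rewrite G3 // -[d]add0n H2 !nth_default // ?size_map ?size_behead //; lia.
- split=> [d|i' le_i|//|i' j' j'R nj].
  + by rewrite E1 F1.
  + by rewrite E2 // F2.
  + by rewrite E4 // F4.
Qed.

End Column.

Definition left_stack (T : tape) (s : seq bool) :=
  forall d : nat, T (- 1 - d%:Z)%R = nth None (map Some (rev s)) d.

Lemma trun_walk_left r T s : left_stack T s ->
  trun (TWhile nonblank (tmoves false 1)) (r, T, - 1)%R (r, T, - 1 - (size s)%:Z)%R
    (size s * 8 + 2).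
Proof.
move=> Ts; have E (d : nat) : (- 1 + d%:Z * toward false 1 = - 1 - d%:Z)%R by rewrite /=; lia.
rewrite -E; apply: (@trun_walk _ _ 4).
- by move=> *; apply: trun_moves.
- by move=> d lt_d; rewrite E Ts (nth_map false) ?size_rev.
- by rewrite E Ts nth_default // size_map size_rev.
Qed.

Lemma trun_walk_right r T s : left_stack T s -> T 0%R = None ->
  trun (TWhile nonblank (tmoves true 1)) (r, T, - (size s)%:Z)%R (r, T, 0%R)
    (size s * 8 + 2).
Proof.
move=> Ts T0; have E : (- (size s)%:Z + (size s)%:Z * toward true 1 = 0)%R by rewrite /=; lia.
apply: (trun_to (esym E)); apply: (@trun_walk _ _ 4).
- by move=> *; apply: trun_moves.
- move=> d lt_d; rewrite [X in T X](_ : _ = - 1 - (size s - d.+1)%:Z)%R; last by rewrite /=; lia.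
  by rewrite Ts (nth_map false) ?size_rev //; lia.
- by rewrite E.
Qed.

Definition push_left (b : bool) :=
  TSeq (TAct (fun _ a => (Some b, a, Some false)))
  (TSeq (TWhile nonblank (tmoves false 1))
  (TSeq (TAct (fun r _ => (r, r, Some true))) (TWhile nonblank (tmoves true 1)))).

Lemma trun_push_left b s r T : T 0%R = None -> left_stack T s ->
  exists r' T', [/\ trun (push_left b) (r, T, 0%R) (r', T', 0%R) ((size s).+1 * 30),
    left_stack T' (b :: s) & forall z, (0 <= z)%R -> T' z = T z].
Proof.
move=> T0 Ts; set T' := twrite T (- 1 - (size s)%:Z)%R (Some b).
have T's : left_stack T' (b :: s).
  move=> d; rewrite /T' /twrite rev_cons map_rcons nth_rcons size_map size_rev Ts.
  case: ltngtP => [lt_d|lt_d|->]; last by rewrite eqxx.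
    by rewrite ifF //; lia.
  by rewrite ifF ?nth_default ?size_map ?size_rev //; lia.
exists (Some b), T'; split=> //; last first.
  by move=> z z0; rewrite /T' /twrite ifF //; lia.
apply: (trun_leq (b := 2 + ((size s * 8 + 2) + (2 + (size s * 8 + 2))))); last lia.
apply: trun_seq; first exact: trun_act.
rewrite twrite_id; apply: trun_seq; first exact: (@trun_walk_left _ _ s).
apply: trun_seq; first exact: trun_act.
apply: (trun_at (h' := - (size s)%:Z)%R); first by rewrite /=; lia.
rewrite -/T'.
have E : (- (size s)%:Z + (size s)%:Z * toward true 1 = 0)%R by rewrite /=; lia.
apply: (trun_to (esym E)); apply: (@trun_walk _ _ 4).
- by move=> *; apply: trun_moves.
- move=> d lt_d; rewrite [X in T' X](_ : _ = - 1 - (size s - d.+1)%:Z)%R; last by rewrite /=; lia.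
  rewrite T's (nth_map false) ?size_rev //=; lia.
- by rewrite E /T' /twrite ifF //; lia.
Qed.

Definition pop_left :=
  TSeq (tmoves false 1)
  (TSeq (TWhile nonblank (tmoves false 1))
  (TSeq (tmoves true 1)
  (TSeq (TAct (fun _ a => (a, None, None)))
  (TIf (fun r _ => r != None) (TSeq (tmoves true 1) (TWhile nonblank (tmoves true 1))) tskip)))).

(** On an empty stack the cell read is the origin itself, which is blank: nothing is lost by erasing
    it and the head is already home. Otherwise the erased cell must be left by one explicit move, as
    the walk home would stop on it. *)
Lemma trun_pop_left s r T : T 0%R = None -> left_stack T s ->
  exists T', [/\ trun pop_left (r, T, 0%R) (ohead s, T', 0%R) ((size s).+1 * 30),
    left_stack T' (behead s) & forall z, (0 <= z)%R -> T' z = T z].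
Proof.
move=> T0 Ts; set T' := twrite T (- (size s)%:Z)%R None.
have Th : T (- (size s)%:Z)%R = ohead s.
  case: s Ts {T'} => [|a s] Ts //.
  rewrite [X in T X](_ : _ = - 1 - (size s)%:Z)%R; last by rewrite /=; lia.
  by rewrite Ts rev_cons map_rcons nth_rcons size_map size_rev ltnn eqxx.
have T's : left_stack T' (behead s).
  move=> d; rewrite /T' /twrite Ts; case: s {Ts T' Th} => [|a s] /=.
    by rewrite ifF //; lia.
  rewrite rev_cons map_rcons nth_rcons size_map size_rev.
  case: ltngtP => [lt_d|lt_d|->]; last by rewrite ifT ?nth_default ?size_map ?size_rev //; lia.
    by rewrite ifF //; lia.
  by rewrite ifF ?nth_default ?size_map ?size_rev //; lia.
exists T'; split=> //; last first.
  move=> z z0; rewrite /T' /twrite; case: eqP => // Ez.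
  by rewrite (_ : z = 0%R) ?T0 //; lia.
apply: (trun_leq (b := 4 + ((size s * 8 + 2) + (4 + (2 + ((4 + (size s * 8 + 2)) + 4)))))); last lia.
apply: trun_seq (trun_moves _ _ _ _ _) _.
apply: (trun_at (h' := - 1)%R); first by rewrite /=; lia.
apply: trun_seq; first exact: (@trun_walk_left _ _ s).
apply: trun_seq (trun_moves _ _ _ _ _) _.
apply: (trun_at (h' := - (size s)%:Z)%R); first by rewrite /=; lia.
apply: trun_seq; first exact: trun_act.
rewrite -/T' Th; apply: trun_if.
case: s Ts @T' Th T's => [|a s] Ts T' Th T's /=.
  by apply: (trun_leq (b := 2)); [exact: trun_skip|lia].
apply: trun_seq (trun_moves _ _ _ _ _) _.
apply: (trun_at (h' := - (size s)%:Z)%R); first by rewrite /=; lia.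
apply: (trun_leq (b := size s * 8 + 2)); last lia.
apply: trun_walk_right => //.
Qed.

End StackOps.

(** * Programs on registers holding bit stacks *)

Definition store := nat -> seq bool.
Definition upd (sg : store) (j : nat) (s : seq bool) : store :=
  fun i => if i == j then s else sg i.

(** [SCase] and [SLoop] test a register by popping it. The programs of [SCase] are for an empty
    register, the bit [false] and the bit [true], in this order; those of [SLoop] are for [false]
    and [true]. *)
Inductive sprog :=
| SSkip
| SPush of nat & bool
| SSeq of sprog & sprog
| SCase of nat & sprog & sprog & sprog
| SLoop of nat & bool & sprog & sprog.

(* [B] caps the size of every register, hence the cost of every push and pop on the tape. The flag
   of a loop makes it stop on the bit [false] too, as at the end of the unary code [enc_nat]. *)
Inductive sexec (B : nat) : sprog -> store -> store -> Prop :=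
| srun_skip sg : sexec B SSkip sg sg
| srun_push j b sg : size (sg j) < B -> sexec B (SPush j b) sg (upd sg j (b :: sg j))
| srun_seq p q sg1 sg2 sg3 : sexec B p sg1 sg2 -> sexec B q sg2 sg3 -> sexec B (SSeq p q) sg1 sg3
| srun_case_nil j p q r sg sg' : sg j = [::] -> sexec B p sg sg' ->
    sexec B (SCase j p q r) sg sg'
| srun_case_cons j p q r b s sg sg' : sg j = b :: s ->
    sexec B (if b then r else q) (upd sg j s) sg' -> sexec B (SCase j p q r) sg sg'
| srun_loop_nil j x q r sg : sg j = [::] -> sexec B (SLoop j x q r) sg sg
| srun_loop_stop j q r s sg : sg j = false :: s -> sexec B (SLoop j true q r) sg (upd sg j s)
| srun_loop_cons j x q r b s sg sg1 sg2 : sg j = b :: s -> b || ~~ x ->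
    sexec B (if b then r else q) (upd sg j s) sg1 -> sexec B (SLoop j x q r) sg1 sg2 ->
    sexec B (SLoop j x q r) sg sg2.

Fixpoint pushes (j : nat) (p : sprog) : bool :=
  match p with
  | SSkip => false
  | SPush i _ => i == j
  | SSeq p q => pushes j p || pushes j q
  | SCase _ p q r => [|| pushes j p, pushes j q | pushes j r]
  | SLoop _ _ q r => pushes j q || pushes j r
  end.

(* The condition on loops bounds their number of rounds by the size of the controlling register. *)
Fixpoint swf (R : nat) (p : sprog) : bool :=
  match p with
  | SSkip => true
  | SPush i _ => i < R
  | SSeq p q => swf R p && swf R q
  | SCase i p q r => [&& i < R, swf R p, swf R q & swf R r]
  | SLoop i _ q r => [&& i < R, swf R q, swf R r & ~~ (pushes i q || pushes i r)]
  end.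

(** Applied to the body of a loop, this shows that the controlling register does not grow back, so
    its size bounds the rounds that are left. *)
Lemma srun_pushes B p sg sg' j : sexec B p sg sg' -> ~~ pushes j p -> size (sg' j) <= size (sg j).
Proof.
move=> H; elim: H => {p sg sg'} //=.
- by move=> i b sg _ ne; rewrite /upd eq_sym (negbTE ne).
- by move=> p q s1 s2 s3 _ IH1 _ IH2 /norP[/IH1 H1 /IH2 H2]; apply: leq_trans H2 H1.
- by move=> i p q r sg sg' _ _ IH /norP[/IH].
- move=> i p q r b s sg sg' E _ IH /norP[_ /norP[nq nr]].
  have /IH H : ~~ pushes j (if b then r else q) by case: b {IH E}.
  by apply: leq_trans H _; rewrite /upd; case: eqP => // ->; rewrite E /=.
- by move=> i q r s sg E _; rewrite /upd; case: eqP => // ->; rewrite E /=.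
- move=> i x q r b s sg sg1 sg2 E _ _ IH1 _ IH2 /norP[nq nr].
  have /IH1 H : ~~ pushes j (if b then r else q) by case: b {IH1 E}.
  have H2 : size (sg2 j) <= size (sg1 j) by apply: IH2; rewrite negb_or nq.
  apply: leq_trans H2 _; apply: leq_trans H _.
  by rewrite /upd; case: eqP => // ->; rewrite E /=.
Qed.

Definition bounded (B : nat) (sg : store) := forall j, size (sg j) <= B.

Lemma bounded_upd B sg j s : bounded B sg -> size s <= B -> bounded B (upd sg j s).
Proof. by move=> H sB i; rewrite /upd; case: eqP. Qed.

Lemma bounded_pop B sg j b s : bounded B sg -> sg j = b :: s -> bounded B (upd sg j s).
Proof. by move=> H E; apply: bounded_upd => //; have := H j; rewrite E; apply: ltnW. Qed.

Lemma srun_bounded B p sg sg' : sexec B p sg sg' -> bounded B sg -> bounded B sg'.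
Proof.
elim=> {p sg sg'} //=.
- by move=> j b sg lt_B H; apply: bounded_upd.
- by move=> p q s1 s2 s3 _ IH1 _ IH2 /IH1/IH2.
- by move=> j p q r b s sg sg' E _ IH H; apply: IH; apply: bounded_pop E.
- by move=> j q r s sg E H; apply: (bounded_pop H E).
- by move=> j x q r b s sg s1 s2 E _ _ IH1 _ IH2 H; apply/IH2/IH1; apply: bounded_pop E.
Qed.

Section Compile.
Variable R : nat.
Hypothesis R0 : 0 < R.

(* Register 0 fills the cells to the left of the origin, its top leftmost, so that the input can
   be read and the output written in place. Entry [i] of register [j > 0] is the cell [i * R + j].
   The cells [i * R] are markers, blank at the origin only among those visited so far. *)
Definition rep (sg : store) (T : tape) :=
  [/\ T (pos R 0 0) = None, left_stack T (sg 0)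
    & forall j, 0 < j < R -> column R j T 0 (sg j)].

Definition spush j b := if j is 0 then push_left b else push_column R j b.
Definition spop j := if j is 0 then pop_left else pop_column R j.

Fixpoint scomp (p : sprog) : tprog :=
  match p with
  | SSkip => tskip
  | SPush j b => spush j b
  | SSeq p q => TSeq (scomp p) (scomp q)
  | SCase j p q r => TSeq (spop j) (TIf (fun r _ => r == None) (scomp p)
      (TIf (fun r _ => r == Some true) (scomp r) (scomp q)))
  | SLoop j x q r => TSeq (spop j)
      (TWhile (fun r _ => (r == Some true) || (r == Some false) && ~~ x)
         (TSeq (TIf (fun r _ => r == Some true) (scomp r) (scomp q)) (spop j)))
  end.

Definition op_cost (B : nat) := B.+1 * (R * 6 + 30).

(** A loop contributes a factor [B], so for a fixed program this is a polynomial in [B] whose degree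
    grows with the nesting of loops. *)
Fixpoint cost (p : sprog) (B : nat) : nat :=
  match p with
  | SSkip => 2
  | SPush j b => op_cost B
  | SSeq p q => cost p B + cost q B
  | SCase j p q r => op_cost B + (cost p B + (cost q B + (cost r B + 8)))
  | SLoop j x q r => B * (op_cost B + (cost q B + (cost r B + 8))) + (op_cost B + 2)
  end.

Lemma rep_column (sg : store) T T' j s : 0 < j < R -> rep sg T -> column R j T' 0 s ->
  frame R j T T' 0 -> rep (upd sg j s) T'.
Proof.
move=> /andP[j0 jR] [T0 T1 T2] Tj [F1 F2 F3 F4]; split=> [|d|i iR]; first by rewrite F2.
  by rewrite F1 T1 /upd ifF //; lia.
rewrite /upd; case: eqP => [->//|/eqP ne] d.
by rewrite F4 // T2.
Qed.

Lemma rep_left (sg : store) T T' s : rep sg T -> left_stack T' s ->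
  (forall z, (0 <= z)%R -> T' z = T z) -> rep (upd sg 0 s) T'.
Proof.
move=> [T0 T1 T2] Ts F; split=> [||i iR d]; [by rewrite F|by []|].
by rewrite F // T2 // /upd ifF //; lia.
Qed.

Lemma trun_spush (sg : store) T r j b B : j < R -> size (sg j) <= B -> rep sg T ->
  exists r' T', trun (spush j b) (r, T, pos R 0 0) (r', T', pos R 0 0) (op_cost B)
    /\ rep (upd sg j (b :: sg j)) T'.
Proof.
move=> jR sB rT; have [T0 T1 T2] := rT; case: j jR sB => [|j] jR sB.
  have [r' [T' [H1 H2 H3]]] := trun_push_left b r T0 T1.
  exists r', T'; split; last exact: rep_left H3.
  by apply: trun_leq H1 _; rewrite /op_cost; nia.
have j1 : 0 < j.+1 < R by [].
have [r' [T' [H1 H2 H3]]] := trun_push_column (ltn0Sn j) jR b r T0 (T2 _ j1).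
exists r', T'; split; last exact: rep_column H3.
by apply: trun_leq H1 _; rewrite /op_cost; nia.
Qed.

Lemma trun_spop (sg : store) T r j B : j < R -> size (sg j) <= B -> rep sg T ->
  exists T', trun (spop j) (r, T, pos R 0 0) (ohead (sg j), T', pos R 0 0) (op_cost B)
    /\ rep (upd sg j (behead (sg j))) T'.
Proof.
move=> jR sB rT; have [T0 T1 T2] := rT; case: j jR sB => [|j] jR sB.
  have [T' [H1 H2 H3]] := trun_pop_left r T0 T1.
  exists T'; split; last exact: rep_left H3.
  by apply: trun_leq H1 _; rewrite /op_cost; nia.
have j1 : 0 < j.+1 < R by [].
have [T' [H1 H2 H3]] := trun_pop_column (ltn0Sn j) jR r T0 (T2 _ j1).
exists T'; split; last exact: rep_column H3.
by apply: trun_leq H1 _; rewrite /op_cost; nia.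
Qed.

Lemma trun_seq_inv p q s s3 b : trun (TSeq p q) s s3 b ->
  exists s2 b1 b2, [/\ trun p s s2 b1, trun q s2 s3 b2 & b1 + b2 <= b].
Proof.
case=> n H nb; inversion H as [|? ? ? s2 ? n1 n2 H1 H2| | | |]; subst.
by exists s2, n1, n2; split=> //; [exists n1|exists n2].
Qed.

Lemma upd_id sg j : upd sg j (sg j) = sg.
Proof. by apply: functional_extensionality => i; rewrite /upd; case: eqP => [->|]. Qed.

(* The cost of a loop is stated with the current size of its register so that the induction on the
   run goes through. *)
Lemma scomp_loop_run B p sg sg' r T : sexec B p sg sg' -> swf R p -> bounded B sg -> rep sg T ->
  exists r' T', trun (scomp p) (r, T, pos R 0 0) (r', T', pos R 0 0)
     (if p is SLoop j x q u then size (sg j) * (op_cost B + (cost q B + (cost u B + 8))) +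
                     (op_cost B + 2) else cost p B) /\ rep sg' T'.
Proof.
have leS p0 sg0 : bounded B sg0 ->
    (if p0 is SLoop j x q u then size (sg0 j) * (op_cost B + (cost q B + (cost u B + 8))) +
       (op_cost B + 2) else cost p0 B) <= cost p0 B.
  by case: p0 => //= j _ q u bB; rewrite leq_add2r leq_mul2r bB orbT.
move=> H; elim: H r T => {p sg sg'}.
- by move=> sg r T _ _ rT; exists r, T; split=> //; apply: trun_skip.
- by move=> j b sg lt_B r T /= jR _ rT; apply: trun_spush => //; apply: ltnW.
- move=> p q s1 s2 s3 H1 IH1 _ IH2 r T /= /andP[wp wq] bB rT.
  have [r1 [T1 [G1 rT1]]] := IH1 r T wp bB rT.
  have bB2 := srun_bounded H1 bB.
  have [r2 [T2 [G2 rT2]]] := IH2 r1 T1 wq bB2 rT1.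
  exists r2, T2; split=> //.
  by apply: trun_seq; apply: trun_leq; [exact: G1|exact: leS|exact: G2|exact: leS].
- move=> j p q u sg sg' E _ IH r T /= /and4P[jR wp _ _] bB rT.
  have [T1 [G1 rT1]] := trun_spop r jR (bB j) rT.
  rewrite E /= in rT1 G1; rewrite -E upd_id in rT1.
  have [r2 [T2 [G2 rT2]]] := IH None T1 wp bB rT1.
  exists r2, T2; split=> //; apply: trun_seq G1 _.
  apply: (trun_leq (b := cost p B + 4)); last lia.
  by apply: trun_if; apply: trun_leq G2 _; apply: leS.
- move=> j p q u b s sg sg' E _ IH r T /= /and4P[jR _ wq wu] bB rT.
  have [T1 [G1 rT1]] := trun_spop r jR (bB j) rT.
  rewrite E /= in rT1 G1.
  have bB1 := bounded_pop bB E.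
  have [|r2 [T2 [G2 rT2]]] := IH (Some b) T1 _ bB1 rT1; first by case: (b).
  exists r2, T2; split=> //; apply: trun_seq G1 _.
  apply: (trun_leq (b := cost (if b then u else q) B + 4 + 4)); last by case: (b); lia.
  apply: trun_if; apply: trun_if => /=.
  by move: (leS (if b then u else q) _ bB1) G2; case: (b) => /= L G2; apply: trun_leq G2 L.
- move=> j x q u sg E r T /= /and4P[jR _ _ _] bB rT.
  have [T1 [G1 rT1]] := trun_spop r jR (bB j) rT.
  rewrite E /= in rT1 G1; rewrite -E upd_id in rT1.
  exists None, T1; split=> //; rewrite E add0n; apply: trun_seq G1 _.
  exact: trun_while_stop.
- move=> j q u s sg E r T /= /and4P[jR _ _ _] bB rT.
  have [T1 [G1 rT1]] := trun_spop r jR (bB j) rT.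
  rewrite E /= in rT1 G1.
  exists (Some false), T1; split=> //.
  apply: (trun_leq (b := op_cost B + 2)); last by rewrite E; lia.
  by apply: trun_seq G1 _; apply: trun_while_stop.
- move=> j x q u b s sg sg1 sg2 E bx H1 IH1 _ IH2 r T /= wL bB rT.
  have /and4P[jR wq wu /norP[npq npu]] := wL.
  have [T1 [G1 rT1]] := trun_spop r jR (bB j) rT.
  rewrite E /= in rT1 G1.
  have bB1 := bounded_pop bB E.
  have [|r2 [T2 [G2 rT2]]] := IH1 (Some b) T1 _ bB1 rT1; first by case: (b).
  have bB2 := srun_bounded H1 bB1.
  have [r3 [T3 [G3 rT3]]] := IH2 r2 T2 wL bB2 rT2.
  exists r3, T3; split=> //.
  (* The run obtained by induction begins with the pop that opens the next round, whereas the
     compiled loop does this pop at the end of its body. The run is cut after that pop and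
     reassembled. *)
  have [s4 [n1 [n2 [K1 K2 le_n]]]] := trun_seq_inv G3.
  have le_s : size (sg1 j) <= size s.
    have := @srun_pushes _ _ _ _ j H1; rewrite /upd eqxx; apply.
    by case: (b).
  have {}G2 : trun (scomp (if b then u else q)) (Some b, T1, pos R 0 0) (r2, T2, pos R 0 0)
      (cost (if b then u else q) B).
    by apply: trun_leq G2 _; apply: leS.
  set W := op_cost B + _ in le_n *.
  apply: (trun_leq (b := op_cost B + ((cost (if b then u else q) B + 4 + n1) + n2 + 4))); last first.
    rewrite E /= mulSn; have : size (sg1 j) * W <= size s * W by rewrite leq_mul2r le_s orbT.
    have : cost (if b then u else q) B + 8 + op_cost B <= W by rewrite /W; case: (b); lia.
    by move: le_n; lia.
  apply: trun_seq G1 _; apply: trun_while_step K2; first by case: (b) bx.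
  by apply: trun_seq K1; apply: trun_if => /=; case: (b) G2.
Qed.

Lemma scomp_run B p sg sg' r T : sexec B p sg sg' -> swf R p -> bounded B sg -> rep sg T ->
  exists r' T', trun (scomp p) (r, T, pos R 0 0) (r', T', pos R 0 0) (cost p B) /\ rep sg' T'.
Proof.
move=> H w bB rT; have [r' [T' [G rT']]] := scomp_loop_run r H w bB rT.
exists r', T'; split=> //; apply: trun_leq G _.
by case: (p) => //= j _ q u; rewrite leq_add2r leq_mul2r bB orbT.
Qed.

(** A compiled program starts and ends at the origin, while the machine starts on the first bit of
    the input and must halt on the first bit of the output. Both bits are at the left end of
    register 0. *)
Definition whole (p : sprog) : tprog :=
  TSeq (TWhile nonblank (tmoves true 1)) (TSeq (scomp p)
    (TSeq (tmoves false 1) (TSeq (TWhile nonblank (tmoves false 1)) (tmoves true 1)))).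

Definition sinit (w : seq bool) : store := upd (fun _ => [::]) 0 w.

Lemma rep_init w : rep (sinit w) (init_tape w).
Proof.
split=> [//|d|j /andP[j0 _] d].
- rewrite /init_tape /sinit /upd eqxx ifT; last lia.
  by congr nth; lia.
- by rewrite /init_tape /sinit /upd ifF /pos ?nth_nil ?gtn_eqF.
Qed.

Lemma whole_run B p w sg' : sexec B p (sinit w) sg' -> swf R p -> size w <= B ->
  exists r' T', trun (whole p) (None, init_tape w, - (size w)%:Z)%R
      (r', T', - (size (sg' 0%N))%:Z)%R (cost p B + B * 16 + 12) /\ rep sg' T'.
Proof.
move=> H wf wB; have bB : bounded B (sinit w) by apply: bounded_upd.
have rT := rep_init w; have [T0 T1 _] := rT.
have [r' [T' [G rT']]] := scomp_run None H wf bB rT.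
have [T'0 T'1 _] := rT'; have bB' := srun_bounded H bB.
exists r', T'; split=> //.
apply: (trun_leq (b := (size w * 8 + 2) + (cost p B + (4 + ((size (sg' 0) * 8 + 2) + 4))))); last first.
  by move: (bB' 0) wB; lia.
apply: trun_seq; first exact: trun_walk_right.
apply: trun_seq G _; apply: trun_seq (trun_moves _ _ _ _ _) _.
apply: trun_seq; first exact: trun_walk_left.
apply: trun_to (trun_moves _ _ _ _ _).
by rewrite /toward; lia.
Qed.

End Compile.

(** * Polynomial bounds and the passage to [ptime_computable] *)

Definition ispoly (F : nat -> nat) := exists c d, forall n, F n <= c * n ^ d + c.

Lemma ispoly_le F G : (forall n, F n <= G n) -> ispoly G -> ispoly F.
Proof. by move=> FG [c [d H]]; exists c, d => n; apply: leq_trans (FG n) (H n). Qed.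

Lemma ispoly_const k : ispoly (fun _ => k).
Proof. by exists k, 0 => n; rewrite leq_addl. Qed.

Lemma ispoly_id : ispoly id.
Proof. by exists 1, 1 => n; rewrite expn1; lia. Qed.

(** The added 1 serves [n = 0], where [0 ^ 0 = 1] but a positive exponent gives 0. *)
Lemma leq_expn_add n a b : n ^ a <= n ^ (a + b) + 1.
Proof.
case: n => [|n]; first by case: a => [|a]; rewrite ?expn0 ?leq_addl // exp0n.
by apply: leq_trans (leq_addr _ _); rewrite leq_pexp2l // leq_addr.
Qed.

Lemma ispolyD F G : ispoly F -> ispoly G -> ispoly (fun n => F n + G n).
Proof.
move=> [c [d HF]] [c' [d' HG]]; exists (2 * (c + c')), (d + d') => n.
apply: leq_trans (leq_add (HF n) (HG n)) _.
by have := leq_expn_add n d d'; have := leq_expn_add n d' d; rewrite [d' + d]addnC; nia.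
Qed.

Lemma ispolyM F G : ispoly F -> ispoly G -> ispoly (fun n => F n * G n).
Proof.
move=> [c [d HF]] [c' [d' HG]]; exists (3 * (c * c')), (d + d') => n.
apply: leq_trans (leq_mul (HF n) (HG n)) _.
have := leq_expn_add n d d'; have := leq_expn_add n d' d; rewrite [d' + d]addnC expnD.
set x := n ^ d; set y := n ^ d' => H1 H2.
have -> : (c * x + c) * (c' * y + c') = c * c' * (x * y + x + y + 1) by ring.
have -> : 3 * (c * c') * (x * y) + 3 * (c * c') = c * c' * (3 * (x * y) + 3) by ring.
by rewrite leq_mul2l; apply/orP; right; lia.
Qed.

Lemma ispoly_cost R p F : ispoly F -> ispoly (fun n => cost R p (F n)).
Proof.
move=> PF; have PO : ispoly (fun n => op_cost R (F n)).
  apply: (ispoly_le (G := fun n => (F n + 1) * (R * 6 + 30))); first by move=> n; rewrite /op_cost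
      addn1.
  by repeat first [done | apply: ispolyM | apply: ispolyD | apply: ispoly_const].
by elim: p => /=; intros; repeat first [done | apply: ispolyD | apply: ispolyM | apply: ispoly_const].
Qed.

Theorem sprog_ptime (X Y : Type) (encX : X -> seq bool) (encY : Y -> seq bool) (P : X -> Prop)
    (G : X -> Y) (R : nat) (p : sprog) (F : nat -> nat) :
  0 < R -> swf R p -> ispoly F ->
  (forall x, P x -> size (encX x) <= F (size (encX x)) /\
     exists2 sg, sexec (F (size (encX x))) p (sinit (encX x)) sg & sg 0 = encY (G x)) ->
  ptime_computable encX encY P G.
Proof.
move=> R0 wf PF HP; set C := tcomp (whole R p) 0.
have [c [d Hc]] : ispoly (fun n => cost R p (F n) + F n * 16 + 12).
  by repeat first [done | apply: ispolyD | apply: ispolyM | apply: ispoly_const | apply: ispoly_cost].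
exists (code_tm C), c, d => x Px; set w := encX x.
have [wB [sg H Hsg]] := HP x Px.
have [r' [T' [[n Hn le_n] [T0 T1 _]]]] := whole_run R0 H wf wB.
have := tcomp_reach Hn (C1 := [::]) (C2 := [::]) (C := C).
rewrite cats0 => /(_ erefl) reach.
have at_n := areach_tm reach (at_state_init C w).
exists n; split; first exact: leq_trans le_n (Hc _).
split; first exact: halted_code_tm at_n.
have [_ kT] := at_n; rewrite -Hsg; apply: tm_output_on_tape kT _ _ => [d' lt_d|].
  rewrite /= [X in T' X](_ : _ = - 1 - (size (sg 0%N) - d'.+1)%:Z)%R; last by rewrite /=; lia.
  rewrite T1 (nth_map false) ?size_rev ?nth_rev; try lia.
  by congr Some; congr nth; lia.
(* The cell after the output is the origin, whose marker is always blank, so the reading of the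
   output ends there. *)
by rewrite /= -[RHS]T0 /pos /=; congr T'; lia.
Qed.

(** * Derived rules and macros for register programs *)

Definition st (l : seq (seq bool)) : store := fun i => nth [::] l i.

(** With the registers in a literal list, updates become [set_nth] and simplify by computation. *)
Lemma upd_st l j s : upd (st l) j s = st (set_nth [::] l j s).
Proof. by apply: functional_extensionality => i; rewrite /st nth_set_nth. Qed.

Lemma srun_eq B p sg sg1 sg2 : sexec B p sg sg1 -> sg1 = sg2 -> sexec B p sg sg2.
Proof. by move=> H <-. Qed.

Notation "p ;; q" := (SSeq p q) (at level 60, right associativity).

Ltac store_eq :=
  apply: functional_extensionality; let x := fresh "x" in
  move=> x; rewrite /upd; repeat case: eqP => //; repeat move=> ?; subst; rewrite ?eqxx //; try lia.

Definition SFor j q := SLoop j true SSkip q.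
Definition SDrain j q r := SLoop j false q r.

Section Rules.
Variable B : nat.
Local Notation srun := (sexec B).

(** [S i v] is the store after [i] rounds with [v] left in the controlling register. An empty [tl]
    is the case of a pure unary counter; a [tl] that starts with [false] is the case of a number at
    the head of a longer code, whose delimiter is popped too. *)
Lemma srun_for j q (S : nat -> seq bool -> store) a tl :
  (forall i v, S i v j = v) -> (forall i v v', upd (S i v) j v' = S i v') ->
  ohead tl != Some true ->
  (forall i, i < a -> srun q (S i (nseq (a - i.+1) true ++ tl)) (S i.+1 (nseq (a - i.+1) true ++
      tl))) ->
  srun (SFor j q) (S 0 (nseq a true ++ tl)) (S a (behead tl)).
Proof.
move=> Sj Su tl0 Hq.
suff H i : i <= a -> srun (SFor j q) (S (a - i) (nseq i true ++ tl)) (S a (behead tl)).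
  by have := H a (leqnn a); rewrite subnn.
elim: i => [|i IHi] le_i.
  rewrite subn0 /=; case: tl tl0 {Hq} => [|[] tl] // _; first exact: srun_loop_nil.
  by rewrite -[in X in sexec _ _ _ X](Su a (false :: tl)); apply: srun_loop_stop.
apply: (@srun_loop_cons _ _ _ _ _ true (nseq i true ++ tl)) => //; last first.
  by apply: IHi; lia.
have -> : a - i = (a - i.+1).+1 by lia.
rewrite Su; have := Hq (a - i.+1); rewrite (_ : a - (a - i.+1).+1 = i); last lia.
by apply; lia.
Qed.

Lemma srun_drain j q r (S : seq bool -> seq bool -> store) s :
  (forall u v, S u v j = v) -> (forall u v v', upd (S u v) j v' = S u v') ->
  (forall u b v, s = u ++ b :: v -> srun (if b then r else q) (S u v) (S (rcons u b) v)) ->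
  srun (SDrain j q r) (S [::] s) (S s [::]).
Proof.
move=> Sj Su Hq.
suff H u v : s = u ++ v -> srun (SDrain j q r) (S u v) (S s [::]) by exact: H.
elim: v u => [|b v IHv] u Es.
  by rewrite cats0 in Es; rewrite -Es; apply: srun_loop_nil.
apply: (@srun_loop_cons _ _ _ _ _ b v) => //; rewrite ?orbT //.
  by rewrite Su; apply: Hq.
by apply: IHv; rewrite cat_rcons.
Qed.

(** Moving a stack reverses it. Two moves in a row restore the order, and a register that collected
    output backwards is put right by one. *)
Definition Move j i := SDrain j (SPush i false) (SPush i true).

Lemma srun_push_eq j b sg sg' : size (sg j) < B -> sg' = upd sg j (b :: sg j) ->
  srun (SPush j b) sg sg'.
Proof. by move=> lt ->; apply: srun_push. Qed.

Lemma srun_move j i sg : i != j -> size (sg j) + size (sg i) <= B ->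
  srun (Move j i) sg (upd (upd sg j [::]) i (rev (sg j) ++ sg i)).
Proof.
move=> ij sB; pose S (u v : seq bool) := upd (upd sg j v) i (rev u ++ sg i).
have -> : sg = S [::] (sg j) by rewrite /S; store_eq.
rewrite [in X in sexec _ _ _ X](_ : upd _ _ _ = S (sg j) [::]); last by rewrite /S; store_eq.
apply: srun_drain => [u v|u v v'|u b v Es].
- by rewrite /S /upd eq_sym (negbTE ij) eqxx.
- by rewrite /S; store_eq.
- have Si : S u v i = rev u ++ sg i by rewrite /S /upd eqxx.
  have lt_B : size (S u v i) < B.
    by rewrite Si size_cat size_rev; move: sB; rewrite Es size_cat /=; lia.
  have E : S (rcons u b) v = upd (S u v) i (b :: S u v i).
    by rewrite Si /S rev_rcons; store_eq.
  by case: b E {Es} => E; apply: srun_push_eq.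
Qed.

Definition Clear j := SDrain j SSkip SSkip.

Lemma srun_clear j sg : srun (Clear j) sg (upd sg j [::]).
Proof.
have := @srun_drain j SSkip SSkip (fun _ v => upd sg j v) (sg j).
rewrite upd_id; apply=> [_ v|_ v v'|_ b v _].
- by rewrite /upd eqxx.
- by store_eq.
- by case: b; apply: srun_skip.
Qed.

Definition ReadNat s d := SFor s (SPush d true).

Lemma srun_readnat s d sg a tl : s != d -> sg s = nseq a true ++ tl ->
  ohead tl != Some true -> a + size (sg d) <= B ->
  srun (ReadNat s d) sg (upd (upd sg s (behead tl)) d (nseq a true ++ sg d)).
Proof.
move=> sd Es tl0 sB; pose S i v := upd (upd sg s v) d (nseq i true ++ sg d).
have -> : sg = S 0 (nseq a true ++ tl) by rewrite /S -Es; store_eq.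
rewrite [in X in sexec _ _ _ X](_ : upd _ _ _ = S a (behead tl)); last first.
  by rewrite /S; store_eq.
apply: srun_for => // [i v|i v v'|i lt_i].
- by rewrite /S /upd (negbTE sd) eqxx.
- by rewrite /S; store_eq.
- apply: srun_push_eq; rewrite /S /upd ?eqxx ?size_cat ?size_nseq; first lia.
  by store_eq.
Qed.

Definition SkipNat s := SFor s SSkip.

Lemma srun_skipnat s sg a tl : sg s = nseq a true ++ tl -> ohead tl != Some true ->
  srun (SkipNat s) sg (upd sg s (behead tl)).
Proof.
move=> Es tl0.
have -> : sg = (fun (_ : nat) v => upd sg s v) 0 (nseq a true ++ tl) by rewrite /= -Es upd_id.
apply: srun_eq; first apply: (srun_for (S := fun _ v => upd sg s v)) => // [i v|i v v'|i _].
- by rewrite /upd eqxx.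
- by store_eq.
- exact: srun_skip.
- by store_eq.
Qed.

(** The delimiter is pushed last, so the number lies in [d] with the end of its code on top, as in
    every register that collects output. *)
Definition ShiftNat s d := ReadNat s d ;; SPush d false.

Lemma srun_shiftnat s d sg a tl : s != d -> sg s = enc_nat a ++ tl -> a.+1 + size (sg d) <= B ->
  srun (ShiftNat s d) sg (upd (upd sg s tl) d (rev (enc_nat a) ++ sg d)).
Proof.
move=> sd Es sB; apply: srun_seq.
  apply: (@srun_readnat _ _ _ a (false :: tl)) => //; last lia.
  by rewrite Es /enc_nat cat_rcons.
apply: srun_push_eq; rewrite /upd ?eqxx ?size_cat ?size_nseq /=; first lia.
have -> : rev (enc_nat a) = false :: nseq a true by rewrite /enc_nat rev_rcons rev_nseq.
by store_eq.
Qed.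

(** Reading [r] empties it, so each unit is pushed on both [d] and [t], and [r] is restored from
    [t]. *)
Definition App d t r := SFor r (SPush t true ;; SPush d true) ;; Move t r ;; SPush d false.

Lemma nseq_cat_true a b : nseq a true ++ nseq b true = nseq (a + b) true.
Proof. by rewrite nseqD. Qed.

Lemma srun_app (d t r : nat) (sg : store) a : d != r -> d != t -> t != r -> sg r = nseq a true ->
    sg t = [::] ->
  a <= B -> a.+1 + size (sg d) <= B ->
  srun (App d t r) sg (upd sg d (rev (enc_nat a) ++ sg d)).
Proof.
move=> dr dt tr Er Et aB sB.
pose S i v := upd (upd (upd sg r v) t (nseq i true)) d (nseq i true ++ sg d).
have H1 : srun (SFor r (SPush t true ;; SPush d true)) sg (S a [::]).
  have {1}-> : sg = S 0 (nseq a true ++ [::]).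
    by rewrite /S cats0 -Er /= -Et; store_eq.
  apply: srun_for => // [i v|i v v'|i lt_i].
  - by rewrite /S /upd eq_sym (negbTE dr) eq_sym (negbTE tr) eqxx.
  - by rewrite /S; store_eq.
  - apply: srun_seq; first apply: srun_push.
      by rewrite /S /upd eq_sym (negbTE dt) eqxx size_nseq; lia.
    apply: srun_push_eq; first by rewrite /S /upd (negbTE dt) eqxx size_cat size_nseq; lia.
    rewrite /S; apply: functional_extensionality => x.
    rewrite /upd (negbTE dt) [t == d]eq_sym (negbTE dt) !eqxx.
    by case: (x =P d) => // _; case: (x =P t).
apply: srun_seq H1 _; apply: srun_seq.
  apply: srun_move; first by rewrite eq_sym.
  rewrite /S /upd [t == d]eq_sym (negbTE dt) eqxx [r == d]eq_sym (negbTE dr) [r == t]eq_sym (negbTE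
      tr) eqxx.
  by rewrite size_nseq addn0.
have -> : rev (enc_nat a) = false :: nseq a true by rewrite /enc_nat rev_rcons rev_nseq.
apply: srun_push_eq.
  by rewrite /S /upd (negbTE dr) (negbTE dt) eqxx size_cat size_nseq; lia.
apply: functional_extensionality => x.
rewrite /S /upd (negbTE dr) (negbTE dt) !eqxx [t == d]eq_sym (negbTE dt) [r == d]eq_sym.
rewrite (negbTE dr) [r == t]eq_sym (negbTE tr).
case: (x =P d) => // _; case: (x =P r) => [->|_]; first by rewrite rev_nseq cats0.
by case: (x =P t) => [->|].
Qed.

Lemma nseq_trueS k k' : k' = k.+1 -> nseq k' true = true :: nseq k true.
Proof. by move=> ->. Qed.

Definition encs (l : seq nat) : seq bool := flatten (map enc_nat l).

Lemma encs_cat l1 l2 : encs (l1 ++ l2) = encs l1 ++ encs l2.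
Proof. by rewrite /encs map_cat flatten_cat. Qed.

Lemma encs_cons a l : encs (a :: l) = nseq a true ++ false :: encs l.
Proof. by rewrite /encs /= /enc_nat cat_rcons. Qed.

Lemma encs1 a : encs [:: a] = enc_nat a.
Proof. by rewrite /encs /= cats0. Qed.

Lemma size_enc_nat a : size (enc_nat a) = a.+1.
Proof. by rewrite /enc_nat size_rcons size_nseq. Qed.

(* Registers: 1 holds the candidate in unary, 2 the list, 7 receives the answer; 3, 4, 5 and 6 are
   scratch. *)
Definition Cmp :=
  SFor 4 (SCase 1 (SPush 6 true) SSkip (SPush 5 true)) ;;
  SCase 1 (SCase 6 (SCase 7 (SPush 7 true) SSkip (SPush 7 true)) SSkip SSkip) SSkip (SPush 1 true) ;;
  Clear 6 ;; Move 5 1.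

Definition Member :=
  SDrain 2 (SPush 3 false ;; Cmp) (SPush 3 true ;; SPush 4 true) ;; Move 3 2.

(** After the loop registers 1, 5 and 6 hold [n - b], [minn n b] and [b - n]. The numbers agree when
    1 and 6 are both empty, and 5 gives back to 1 what was taken. The answer is popped before it is
    pushed, which keeps it a single bit. *)
Lemma srun_cmp io n q qs b (f : bool) rest : n <= B -> b <= B -> 0 < B ->
  srun Cmp (st [:: io, nseq n true, q, qs, nseq b true, [::], [::], nseq f true & rest])
    (st [:: io, nseq n true, q, qs, [::], [::], [::], nseq (f || (n == b)) true & rest]).
Proof.
move=> nB bB B0; apply: srun_seq.
  have := @srun_for 4 (SCase 1 (SPush 6 true) SSkip (SPush 5 true))
   (fun i v => st [:: io, nseq (n - i) true, q, qs, v, nseq (minn n i) true, nseq (i - n) true,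
      nseq f true & rest]) b [::].
  rewrite cats0 subn0 minn0 sub0n; apply=> // [i v v'|i lt_i]; first by rewrite upd_st.
  case: (ltnP i n) => lt_n.
    apply: (@srun_case_cons _ _ _ _ _ true (nseq (n - i.+1) true)).
      by rewrite /=; apply: nseq_trueS; lia.
    apply: srun_push_eq; first by rewrite /upd /= size_nseq; lia.
    have -> : i - n = 0 by lia.
    have -> : i.+1 - n = 0 by lia.
    rewrite !upd_st /=.
    by congr (st [:: _, _, _, _, _, _, _, _ & _]); apply: nseq_trueS; lia.
  apply: srun_case_nil; first by rewrite /= (_ : n - i = 0) //; lia.
  apply: srun_push_eq; first by rewrite /= size_nseq; lia.
  have -> : n - i = 0 by lia.
  have -> : n - i.+1 = 0 by lia.
  rewrite !upd_st /=.
  congr (st [:: _, _, _, _, _, _, _, _ & _]); first by congr nseq; lia.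
  by apply: nseq_trueS; lia.
(* When [n < b] the test has popped one bit of register 6, hence [b - n - 1]; the register is
   cleared anyway. *)
have M g : srun (Clear 6 ;; Move 5 1)
    (st [:: io, nseq (n - b) true, q, qs, [::], nseq (minn n b) true, nseq (b - n - 1) true, g & rest])
    (st [:: io, nseq n true, q, qs, [::], [::], [::], g & rest]).
  apply: srun_seq; first exact: srun_clear.
  apply: srun_eq; first apply: srun_move => //.
    by rewrite /upd /= !size_nseq; lia.
  by rewrite !upd_st /= rev_nseq nseq_cat_true (_ : minn n b + (n - b) = n) //; lia.
have [lt_nb|lt_bn|En] := ltngtP n b.
- apply: srun_seq (M _); rewrite orbF (_ : n - b = 0); last lia.
  apply: srun_case_nil => //.
  apply: (@srun_case_cons _ _ _ _ _ true (nseq (b - n - 1) true)).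
    by rewrite /=; apply: nseq_trueS; lia.
  by rewrite upd_st /= (minn_idPl (ltnW lt_nb)); apply: srun_skip.
- apply: srun_seq (M _); rewrite orbF.
  apply: (@srun_case_cons _ _ _ _ _ true (nseq (n - b - 1) true)).
    by rewrite /=; apply: nseq_trueS; lia.
  apply: srun_push_eq; first by rewrite /upd /= size_nseq; lia.
  rewrite !upd_st /= (_ : b - n = 0) ?(minn_idPr (ltnW lt_bn)); last lia.
  by congr (st [:: _, _, _, _, _, _, _, _ & _]); apply: nseq_trueS; lia.
- have := M [:: true]; rewrite -En subnn minnn sub0n => {}M.
  rewrite orbT; apply: srun_seq M; apply: srun_case_nil => //; apply: srun_case_nil => //.
  case: f => /=.
    apply: (@srun_case_cons _ _ _ _ _ true [::]) => //.
    apply: srun_push_eq => //.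
    by rewrite !upd_st.
  apply: srun_case_nil => //.
  by apply: srun_push_eq => //; rewrite !upd_st.
Qed.

Lemma srun_mem io n l rest : n <= B -> size (encs l) <= B ->
  srun Member (st [:: io, nseq n true, encs l, [::], [::], [::], [::], [::] & rest])
    (st [:: io, nseq n true, encs l, [::], [::], [::], [::], nseq (n \in l) true & rest]).
Proof.
move=> nB lB.
have H l2 : forall qs (f : bool), size qs + size (encs l2) <= B ->
    srun (SDrain 2 (SPush 3 false ;; Cmp) (SPush 3 true ;; SPush 4 true))
     (st [:: io, nseq n true, encs l2, qs, [::], [::], [::], nseq f true & rest])
     (st [:: io, nseq n true, [::], rev (encs l2) ++ qs, [::], [::], [::], nseq (f || (n \in l2))
         true & rest]).
  elim: l2 => [|b l2 IHl] qs f sB.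
    by rewrite orbF /=; apply: srun_loop_nil.
  (* Invariant inside the entry [b]: [d] of its units are already in register 4 and [c] are still to
     be read. *)
  have G c d qs' : c + d = b -> size qs' + (c + (size (encs l2)).+1) <= B ->
    srun (SDrain 2 (SPush 3 false ;; Cmp) (SPush 3 true ;; SPush 4 true))
     (st [:: io, nseq n true, nseq c true ++ false :: encs l2, qs', nseq d true, [::], [::], nseq f
         true & rest])
     (st [:: io, nseq n true, [::], rev (encs l2) ++ false :: nseq c true ++ qs', [::], [::], [::],
         nseq (f || (n \in b :: l2)) true & rest]).
    elim: c d qs' => [|c IHc] d qs' Ed sB' /=.
      apply: (@srun_loop_cons _ _ _ _ _ false (encs l2)) => //.
        rewrite upd_st /=; apply: srun_seq; first by apply: srun_push => /=; lia.
        rewrite upd_st /=; apply: srun_cmp => //.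
          by move: sB; rewrite encs_cons size_cat size_nseq; lia.
        by move: sB; rewrite encs_cons size_cat /=; lia.
      rewrite -Ed inE orbA add0n; apply: IHl; rewrite /=; lia.
    apply: (@srun_loop_cons _ _ _ _ _ true (nseq c true ++ false :: encs l2)) => //.
      rewrite upd_st /=; apply: srun_seq; first by apply: srun_push => /=; lia.
      rewrite upd_st /=; apply: srun_push; rewrite /= size_nseq.
      by move: sB; rewrite encs_cons size_cat size_nseq; lia.
    rewrite upd_st /=; have := IHc d.+1 (true :: qs').
    rewrite (_ : nseq c true ++ true :: qs' = true :: nseq c true ++ qs'); last first.
      by rewrite -cat_rcons -[rcons _ _]cats1 (nseq_cat_true c 1) addn1.
    by apply=> /=; lia.
  have := G b 0 qs; rewrite addn0 encs_cons rev_cat rev_cons rev_nseq -cats1 -!catA.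
  apply=> //; move: sB; rewrite encs_cons size_cat size_nseq /=; lia.
apply: srun_seq.
  by apply: (H l [::] false).
apply: srun_eq; first apply: srun_move => //.
  by rewrite /= cats0 size_rev addn0.
by rewrite !upd_st /= !cats0 revK.
Qed.

Definition vote (c : nat) (q : seq nat) : seq nat := q ++ [seq a <- iota 0 c | a \notin q].

(* Registers: 8 collects the output (last bit on top), 9 counts the votes, 10 holds the number of
   candidates in unary, 11 the prefix of the vote (last bit on top). *)
Definition Emit :=
  Move 11 2 ;; App 8 5 10 ;;
  SDrain 2 (SPush 3 false ;; SPush 8 false) (SPush 3 true ;; SPush 8 true) ;; Move 3 2 ;;
  SFor 10 (Member ;; SCase 7 (App 8 5 1) SSkip SSkip ;; SPush 1 true) ;;
  Move 1 10 ;; Clear 2 ;; SPush 9 true.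

Lemma perm_vote c (q : seq nat) : uniq q -> all (fun a => a < c) q -> perm_eq (vote c q) (iota 0 c).
Proof.
move=> uq qc; apply: uniq_perm; last 1 first.
- move=> x; rewrite mem_cat mem_filter mem_iota /= add0n; case: (boolP (x \in q)) => //= xq.
  by rewrite (allP qc).
- rewrite cat_uniq uq filter_uniq ?iota_uniq // andbT /=.
  by apply/hasPn => x; rewrite mem_filter => /andP[].
- exact: iota_uniq.
Qed.

Lemma size_vote c (q : seq nat) : uniq q -> all (fun a => a < c) q -> size (vote c q) = c.
Proof. by move=> uq qc; rewrite (perm_size (perm_vote uq qc)) size_iota. Qed.

Lemma srun_emit io V cnt c (q : seq nat) rest : uniq q -> all (fun a => a < c) q -> c <= B ->
  size V + size (enc_seq enc_nat (vote c q)) <= B -> size cnt < B ->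
  srun Emit
   (st [:: io, [::], [::], [::], [::], [::], [::], [::], V, cnt, nseq c true, rev (encs q) & rest])
   (st [:: io, [::], [::], [::], [::], [::], [::], [::], rev (enc_seq enc_nat (vote c q)) ++ V,
        true :: cnt, nseq c true, [::] & rest]).
Proof.
move=> uq qc cB VB cntB; have Ev := size_vote uq qc.
have sE : size (enc_seq enc_nat (vote c q)) =
    c.+1 + (size (encs q) + size (encs [seq a <- iota 0 c | a \notin q])).
  by rewrite /enc_seq Ev size_cat size_enc_nat -/(encs _) encs_cat size_cat.
rewrite sE in VB.
apply: srun_seq; first apply: srun_move => //.
  by rewrite /= size_rev; lia.
rewrite !upd_st /= revK cats0.
apply: srun_seq; first by apply: (@srun_app _ _ _ _ c) => //=; lia.
rewrite !upd_st /=; set V1 := rev (enc_nat c) ++ V.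
have sV1 : size V1 = c.+1 + size V by rewrite size_cat size_rev size_enc_nat.
apply: srun_seq.
  apply: (@srun_drain _ _ _ (fun u v => st [:: io, [::], v, rev u, [::], [::], [::], [::],
     rev u ++ V1, cnt, nseq c true, [::] & rest])) => // [u v v'|u b v Eq].
    by rewrite upd_st.
  have := congr1 size Eq; rewrite size_cat /= => Es.
  have G b' : srun (SPush 3 b' ;; SPush 8 b') (st [:: io, [::], v, rev u, [::], [::], [::], [::],
     rev u ++ V1, cnt, nseq c true, [::] & rest]) (st [:: io, [::], v, rev (rcons u b'), [::],
         [::], [::], [::],
     rev (rcons u b') ++ V1, cnt, nseq c true, [::] & rest]).
    apply: srun_seq; first by apply: srun_push; rewrite /= size_rev; lia.
    rewrite upd_st /=; apply: srun_push_eq; first by rewrite /= size_cat size_rev; lia.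
    by rewrite upd_st /= rev_rcons.
  by case: b {Eq} => /=; apply: G.
apply: srun_seq; first apply: srun_move => //.
  by rewrite /= size_rev; lia.
rewrite !upd_st /= revK cats0; set V2 := rev (encs q) ++ V1.
have sV2 : size V2 = size (encs q) + size V1 by rewrite size_cat size_rev.
apply: srun_seq.
  (* Register 1 counts up while 10 counts down: it holds the candidate to be tested, and at the end
     it refills 10. *)
  pose S i v := st [:: io, nseq i true, encs q, [::], [::], [::], [::], [::],
     rev (encs [seq a <- iota 0 i | a \notin q]) ++ V2, cnt, v, [::] & rest].
  have := @srun_for 10 (Member ;; SCase 7 (App 8 5 1) SSkip SSkip ;; SPush 1 true) S c [::].
  rewrite cats0; apply=> // [i v v'|i lt_i]; first by rewrite upd_st.
  set v := nseq (c - i.+1) true ++ [::]; rewrite /S.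
  have si : size (encs [seq a <- iota 0 i.+1 | a \notin q]) <=
            size (encs [seq a <- iota 0 c | a \notin q]).
    by rewrite -(subnKC lt_i) iotaD filter_cat encs_cat size_cat leq_addr.
  apply: srun_seq; first by apply: srun_mem; lia.
  apply: (srun_seq (sg2 := st [:: io, nseq i true, encs q, [::], [::], [::], [::], [::],
     rev (encs [seq a <- iota 0 i.+1 | a \notin q]) ++ V2, cnt, v, [::] & rest])); last first.
    by apply: srun_push_eq; rewrite /= ?upd_st // size_nseq; lia.
  rewrite -addn1 iotaD filter_cat /= add0n in si *.
  case: (boolP (i \in q)) => iq /=.
    apply: (@srun_case_cons _ _ _ _ _ true [::]) => //.
    by rewrite cats0 upd_st; apply: srun_skip.
  rewrite (negbTE iq) /= in si; rewrite encs_cat size_cat in si.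
  apply: srun_case_nil => //; apply: srun_eq.
    apply: (@srun_app _ _ _ _ i) => //=; first lia.
    rewrite size_cat size_rev sV2 sV1; rewrite encs1 size_enc_nat in si.
    by move: si VB; set x := size (encs (filter _ _)); set y := size (encs (filter _ _)); lia.
  by rewrite !upd_st /= encs_cat encs1 rev_cat -catA.
rewrite /=; apply: srun_seq; first apply: srun_move => //.
  by rewrite /= size_nseq addn0.
rewrite !upd_st /= rev_nseq cats0.
apply: srun_seq; first exact: srun_clear.
rewrite upd_st /=; apply: srun_push_eq => //.
rewrite upd_st /=; congr (st [:: _, _, _, _, _, _, _, _, _ & _]).
by rewrite /enc_seq Ev -/(encs _) rev_cat encs_cat rev_cat -!catA.
Qed.

End Rules.

(** * The reduction and its program *)

(* Candidates: the elements [0..n-1], their partners [n..2n-1], then w = 2n, z = 2n+1 and p =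
   2n+2. Let cov of the m sets be included in the set of deleted candidates, which contains t
   elements and t' partners. Then p scores m(2+t')+1+cov, w scores m(2+t')+k and z scores
   m(1+t)+k. *)
Definition block (n : nat) (s : seq nat) : seq (seq nat) :=
  [:: rcons s (n.*2 + 2); [:: n.*2 + 2]; [:: n.*2 + 2]; [:: n.*2]; [:: n.*2]; [:: n.*2 + 1]] ++
  flatten [seq [:: [:: u; n.*2 + 1]; [:: n + u; n.*2 + 2]; [:: n + u; n.*2]] | u <- iota 0 n].

Arguments block : simpl never.

(** Outside the blocks each rival gets [k] votes and p gets one, so that, with both rivals present,
    p overtakes w exactly when at least [k] sets are covered. *)
Definition prefixes (x : mku_inst) : seq (seq nat) :=
  let n := mku_n x in
  flatten (map (block n) (mku_sets x)) ++
  flatten (nseq (mku_k x) [:: [:: n.*2]; [:: n.*2 + 1]]) ++ [:: [:: n.*2 + 2]].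

Definition ccdc_of_mku (x : mku_inst) : ccdc_inst :=
  MkCCDC ((mku_n x).*2 + 3) (map (vote ((mku_n x).*2 + 3)) (prefixes x)) ((mku_n x).*2 + 2).

Definition okp (c : nat) (q : seq nat) := uniq q && all (fun a => a < c) q.

Definition encv (c : nat) (qs : seq (seq nat)) : seq bool :=
  flatten (map (enc_seq enc_nat) (map (vote c) qs)).

Lemma encv_rcons c qs q : encv c (rcons qs q) = encv c qs ++ enc_seq enc_nat (vote c q).
Proof. by rewrite /encv -cats1 !map_cat flatten_cat /= cats0. Qed.

Lemma size_encs_le c l : all (fun a => a < c) l -> size (encs l) <= size l * c.
Proof.
elim: l => //= a l IHl /andP[ac /IHl H].
by rewrite encs_cons size_cat size_nseq /= mulSn addnS -addSn leq_add.
Qed.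

Lemma okp_vote c q : okp c q -> size (vote c q) = c /\ all (fun a => a < c) (vote c q).
Proof.
move=> /andP[uq qc]; rewrite size_vote //; split=> //.
rewrite all_cat qc; apply/allP => a; rewrite mem_filter mem_iota add0n.
by case/andP.
Qed.

(** The length takes [c.+1] bits, and each of the [c] candidates at most [c] bits. *)
Lemma size_enc_vote c q : okp c q -> size (enc_seq enc_nat (vote c q)) <= c.+1 * c.+1.
Proof.
move=> /okp_vote[sv va]; rewrite /enc_seq size_cat size_enc_nat -/(encs _) sv.
by have := size_encs_le va; rewrite sv; nia.
Qed.

Lemma size_encs_okp c q : okp c q -> size (encs q) <= c.+1 * c.+1.
Proof.
move=> H; apply: leq_trans (size_enc_vote H).
rewrite /enc_seq size_cat -/(encs _) {2}/vote encs_cat (size_cat (encs q)).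
exact: leq_trans (leq_addr _ _) (leq_addl _ _).
Qed.

Lemma size_encv c qs : all (okp c) qs -> size (encv c qs) <= size qs * (c.+1 * c.+1).
Proof.
elim: qs => //= q qs IHq /andP[/size_enc_vote sq /IHq H].
rewrite -[encv _ _]/(enc_seq enc_nat (vote c q) ++ encv c qs) size_cat mulSn; lia.
Qed.

Section Program.
Variables (B J n : nat).
Let c := n.*2 + 3.
Hypothesis leB : J.+1 * (c.+1 * c.+1) <= B.

Local Notation srun := (sexec B).

Let cB : c.+1 * c.+1 <= B. Proof. by apply: leq_trans leB; rewrite leq_pmull. Qed.
Let JB : J < B.
Proof. by apply: leq_trans leB; rewrite leq_pmulr. Qed.
Let nB : n.*2 + 4 <= B.
Proof.
apply: leq_trans cB; rewrite (_ : n.*2 + 4 = c.+1) ?leq_pmulr //; rewrite /c; lia.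
Qed.

(** With [leB] this makes the encoded votes fit into [B]. It passes to initial segments, so it has
    to be checked only for the complete list of votes. *)
Definition room (qs : seq (seq nat)) := all (okp c) qs && (size qs <= J).

Lemma room_cat qs qs' : room (qs ++ qs') -> room qs.
Proof. by rewrite /room all_cat size_cat => /andP[/andP[-> _] /=]; lia. Qed.

Definition est io qs qr (rest : seq (seq bool)) :=
  st [:: io, [::], [::], [::], [::], [::], [::], [::], rev (encv c qs), nseq (size qs) true,
      nseq c true, qr & rest].

Lemma srun_emit_est io qs q rest : room (rcons qs q) ->
  srun Emit (est io qs (rev (encs q)) rest) (est io (rcons qs q) [::] rest).
Proof.
move=> /andP[]; rewrite all_rcons size_rcons => /andP[okq okqs] sJ.
rewrite /est encv_rcons rev_cat size_rcons; have /andP[uq qc] := okq.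
apply: srun_emit => //; first by move: cB; nia.
  rewrite size_rev; have := size_encv okqs; have := size_enc_vote okq.
  by move: leB sJ; nia.
by rewrite size_nseq; apply: ltn_trans JB.
Qed.

Definition Emit1 r := App 11 5 r ;; Emit.
Definition Emit2 r r' := App 11 5 r ;; App 11 5 r' ;; Emit.

Lemma encs_rcons q a : encs (rcons q a) = encs q ++ enc_nat a.
Proof. by rewrite -cats1 encs_cat encs1. Qed.

Lemma srun_app_est io qs q a r rest : 11 < r -> nth [::] rest (r - 12) = nseq a true ->
  okp c (rcons q a) ->
  srun (App 11 5 r) (est io qs (rev (encs q)) rest) (est io qs (rev (encs (rcons q a))) rest).
Proof.
move=> r11 Er okq.
have ac : a < c by case/andP: okq => _; rewrite all_rcons => /andP[].
apply: srun_eq; first apply: (@srun_app _ _ _ _ _ a) => //=.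
- by rewrite ltn_eqF.
- by rewrite ltn_eqF //; apply: ltn_trans r11.
- by rewrite -Er /est /st -[in LHS](subnK r11) [_ - 12 + 12]addnC.
- by move: cB; nia.
- rewrite size_rev; have := size_encs_okp okq.
  by rewrite encs_rcons size_cat size_enc_nat; move: cB; lia.
by rewrite /est upd_st /= encs_rcons rev_cat.
Qed.

Lemma okp_rcons q a : okp c (rcons q a) -> okp c q.
Proof.
by rewrite /okp rcons_uniq all_rcons => /andP[/andP[_ ->] /andP[_ ->]].
Qed.

Lemma room_last qs q : room (rcons qs q) -> okp c q.
Proof. by rewrite /room all_rcons => /andP[/andP[]]. Qed.

Lemma srun_emit1 io qs q a r rest : 11 < r -> nth [::] rest (r - 12) = nseq a true ->
  room (rcons qs (rcons q a)) ->
  srun (Emit1 r) (est io qs (rev (encs q)) rest) (est io (rcons qs (rcons q a)) [::] rest).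
Proof.
move=> r11 Er rm; apply: srun_seq; last exact: srun_emit_est rm.
by apply: srun_app_est r11 Er _; apply: room_last rm.
Qed.

Lemma srun_emit2 io qs a b r r' rest : 11 < r -> nth [::] rest (r - 12) = nseq a true ->
  11 < r' -> nth [::] rest (r' - 12) = nseq b true ->
  room (rcons qs [:: a; b]) ->
  srun (Emit2 r r') (est io qs [::] rest) (est io (rcons qs [:: a; b]) [::] rest).
Proof.
move=> r11 Er r11' Er' rm; have ok2 := room_last rm; apply: srun_seq.
  by apply: (@srun_app_est io qs [::] a r rest r11 Er); apply: (@okp_rcons [:: a] b).
exact: (@srun_emit1 io qs [:: a] b r' rest r11' Er' rm).
Qed.

(** Registers 12 to 20: the number of elements, the candidates w, z and p, the current element and
    its partner, the number of sets left, the length of the current set, and scratch. *)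
Definition fregs v12 u u2 mm l t2 : seq (seq bool) :=
  [:: v12; nseq n.*2 true; nseq (n.*2 + 1) true; nseq (n.*2 + 2) true; u; u2; mm; l; t2].

(** Register 12 controls both loops but is needed again for the next set, so every round copies its
    unit to register 20. The first loop also starts the partner counter 17 at [n]. *)
Definition ElementBlock :=
  SFor 12 (SPush 20 true ;; SPush 17 true) ;; Move 20 12 ;;
  SFor 12 (SPush 20 true ;; Emit2 16 14 ;; Emit2 17 15 ;; Emit2 17 13 ;;
           SPush 16 true ;; SPush 17 true) ;;
  Move 20 12 ;; Clear 16 ;; Clear 17.

Definition triples i :=
  flatten [seq [:: [:: u; n.*2 + 1]; [:: n + u; n.*2 + 2]; [:: n + u; n.*2]] | u <- iota 0 i].

Arguments triples : simpl never.

Lemma triplesS i : triples i.+1 =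
  triples i ++ [:: [:: i; n.*2 + 1]; [:: n + i; n.*2 + 2]; [:: n + i; n.*2]].
Proof. by rewrite /triples -[i.+1]addn1 iotaD map_cat flatten_cat. Qed.

Lemma room_triples qs i : i <= n -> room (qs ++ triples n) -> room (qs ++ triples i).
Proof.
move=> le_i; rewrite /triples -(subnKC le_i) iotaD map_cat flatten_cat catA.
exact: room_cat.
Qed.

Lemma srun_element_block io qs mm l : room (qs ++ triples n) ->
  srun ElementBlock (est io qs [::] (fregs (nseq n true) [::] [::] mm l [::]))
    (est io (qs ++ triples n) [::] (fregs (nseq n true) [::] [::] mm l [::])).
Proof.
move=> rm.
apply: srun_seq.
  have := @srun_for B 12 (SPush 20 true ;; SPush 17 true) (fun i v =>
    est io qs [::] (fregs v [::] (nseq i true) mm l (nseq i true))) n [::].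
  rewrite cats0; apply=> // [i v v'|i lt_i]; first by rewrite upd_st.
  apply: srun_seq; first by apply: srun_push; rewrite /= size_nseq; lia.
  rewrite upd_st /=; apply: srun_push_eq; first by rewrite /= size_nseq; lia.
  by rewrite upd_st.
apply: srun_seq; first apply: srun_move => //.
  by rewrite /= size_nseq; lia.
rewrite !upd_st /= rev_nseq cats0.
apply: srun_seq.
  have := @srun_for B 12 (SPush 20 true ;; Emit2 16 14 ;; Emit2 17 15 ;; Emit2 17 13 ;;
           SPush 16 true ;; SPush 17 true) (fun i v =>
    est io (qs ++ triples i) [::] (fregs v (nseq i true) (nseq (n + i) true) mm l (nseq i true))) n
        [::].
  rewrite /= addn0 !cats0.
  apply=> // [i v v'|i lt_i]; first by rewrite upd_st.
  rewrite /= cats0 triplesS.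
  have rmi := room_triples lt_i rm; rewrite triplesS in rmi.
  have rm1 : room (rcons (qs ++ triples i) [:: i; n.*2 + 1]).
    by apply: (@room_cat _ [:: [:: n + i; n.*2 + 2]; [:: n + i; n.*2]]); rewrite -cats1 -!catA.
  have rm2 : room (rcons (rcons (qs ++ triples i) [:: i; n.*2 + 1]) [:: n + i; n.*2 + 2]).
    by apply: (@room_cat _ [:: [:: n + i; n.*2]]); rewrite -!cats1 -!catA.
  have rm3 : room (rcons (rcons (rcons (qs ++ triples i) [:: i; n.*2 + 1]) [:: n + i; n.*2 + 2])
      [:: n + i; n.*2]).
    by rewrite -!cats1 -!catA.
  apply: srun_seq; first by apply: srun_push; rewrite /= size_nseq; lia.
  rewrite upd_st /= -/(nseq n.+3 true).
  rewrite [st _]/(est io (qs ++ triples i) [::] (fregs (nseq (n - i.+1) true) (nseq i true)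
     (nseq (n + i) true) mm l (nseq i.+1 true))).
  apply: srun_seq; first exact: (@srun_emit2 _ _ (i) (n.*2 + 1)).
  apply: srun_seq; first exact: (@srun_emit2 _ _ (n + i) (n.*2 + 2)).
  apply: srun_seq; first exact: (@srun_emit2 _ _ (n + i) (n.*2)).
  apply: srun_seq; first by apply: srun_push; rewrite /= size_nseq; lia.
  rewrite upd_st /=; apply: srun_push_eq; first by rewrite /= size_nseq; lia.
  by rewrite upd_st /est /fregs /= -!cats1 -!catA [n + i.+1]addnS.
apply: srun_seq; first apply: srun_move => //.
  by rewrite /= size_nseq; lia.
rewrite !upd_st /= rev_nseq cats0.
apply: srun_seq; first exact: srun_clear.
rewrite !upd_st /=; apply: srun_eq; first exact: srun_clear.
by rewrite upd_st.
Qed.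

Definition ReadSet := ReadNat 0 19 ;; SFor 19 (ShiftNat 0 11).

Definition Block :=
  ReadSet ;; Emit1 15 ;; Emit1 15 ;; Emit1 15 ;; Emit1 13 ;; Emit1 13 ;; Emit1 14 ;; ElementBlock.

Lemma srun_read_set io qs s v12 u u2 mm t2 : size s <= B -> size (encs s) <= B ->
  srun ReadSet (est (enc_seq enc_nat s ++ io) qs [::] (fregs v12 u u2 mm [::] t2))
    (est io qs (rev (encs s)) (fregs v12 u u2 mm [::] t2)).
Proof.
move=> sB esB; apply: srun_seq.
  apply: (@srun_readnat _ _ _ _ (size s) (false :: encs s ++ io)) => //=; last by rewrite addn0.
  by rewrite /est /st /= /enc_seq /enc_nat -catA cat_rcons.
rewrite !upd_st /= cats0.
have := @srun_for B 19 (ShiftNat 0 11) (fun i v =>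
   est (encs (drop i s) ++ io) qs (rev (encs (take i s))) (fregs v12 u u2 mm v t2)) (size s) [::].
rewrite drop0 take0 take_size drop_size cats0; apply=> // [i v v'|i lt_i]; first by rewrite upd_st.
have lt_s := lt_i; rewrite (take_nth 0) // encs_rcons.
have Es := congr1 (size \o encs) (cat_take_drop i.+1 s).
rewrite /= encs_cat (take_nth 0) // encs_rcons !size_cat size_enc_nat in Es.
apply: srun_eq; first apply: (@srun_shiftnat _ _ _ _ (nth 0 s i) (encs (drop i.+1 s) ++ io)) => //.
- by rewrite /= (drop_nth 0) // encs_cons /enc_nat cat_rcons -catA.
- by rewrite /= size_rev; lia.
by rewrite !upd_st /= rev_cat.
Qed.

Lemma srun_block io qs s mm : size s <= B -> room (qs ++ block n s) ->
  srun Block (est (enc_seq enc_nat s ++ io) qs [::] (fregs (nseq n true) [::] [::] mm [::] [::]))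
    (est io (qs ++ block n s) [::] (fregs (nseq n true) [::] [::] mm [::] [::])).
Proof.
move=> sB rm.
pose q1 := rcons qs (rcons s (n.*2 + 2)); pose q2 := rcons q1 [:: n.*2 + 2].
pose q3 := rcons q2 [:: n.*2 + 2]; pose q4 := rcons q3 [:: n.*2].
pose q5 := rcons q4 [:: n.*2]; pose q6 := rcons q5 [:: n.*2 + 1].
have Eb : qs ++ block n s = q6 ++ triples n by rewrite /block /q6 /q5 /q4 /q3 /q2 /q1 !cat_rcons.
rewrite Eb in rm *.
have rm6 := room_cat rm; rewrite /q6 -cats1 in rm6; have rm5 := room_cat rm6.
rewrite /q5 -cats1 in rm5; have rm4 := room_cat rm5.
rewrite /q4 -cats1 in rm4; have rm3 := room_cat rm4.
rewrite /q3 -cats1 in rm3; have rm2 := room_cat rm3.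
rewrite /q2 -cats1 in rm2; have rm1 := room_cat rm2.
do [rewrite cats1 in rm2; rewrite cats1 in rm3; rewrite cats1 in rm4; rewrite cats1 in rm5; rewrite
    cats1 in rm6].
have oks := okp_rcons (room_last rm1).
apply: srun_seq; first by apply: srun_read_set => //; have := size_encs_okp oks; move: cB; lia.
apply: srun_seq; first by apply: (@srun_emit1 _ _ s _ _ _ _ _ rm1).
apply: srun_seq; first by apply: (@srun_emit1 _ _ [::] _ _ _ _ _ rm2).
apply: srun_seq; first by apply: (@srun_emit1 _ _ [::] _ _ _ _ _ rm3).
apply: srun_seq; first by apply: (@srun_emit1 _ _ [::] _ _ _ _ _ rm4).
apply: srun_seq; first by apply: (@srun_emit1 _ _ [::] _ _ _ _ _ rm5).
apply: srun_seq; first by apply: (@srun_emit1 _ _ [::] _ _ _ _ _ rm6).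
exact: srun_element_block.
Qed.

Definition Init :=
  SFor 0 (SPush 12 true ;; SPush 13 true ;; SPush 13 true ;; SPush 14 true ;; SPush 14 true ;;
    SPush 15 true ;; SPush 15 true ;; SPush 10 true ;; SPush 10 true) ;;
  SPush 14 true ;; SPush 15 true ;; SPush 15 true ;; SPush 10 true ;; SPush 10 true ;; SPush 10 true ;;
  ReadNat 0 18.

Ltac push_step :=
  apply: srun_seq; [apply: srun_push; rewrite /= ?size_nseq; lia | rewrite upd_st /=].

Lemma srun_init io m : m <= B ->
  srun Init (sinit (enc_nat n ++ enc_nat m ++ io))
    (est io [::] [::] (fregs (nseq n true) [::] [::] (nseq m true) [::] [::])).
Proof.
move=> mB; pose io1 := enc_nat m ++ io; rewrite -/io1.
have Es : sinit (enc_nat n ++ io1) = st ((enc_nat n ++ io1) :: nseq 20 [::]).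
  apply: functional_extensionality => i; rewrite /sinit /upd /st.
  by do 21!(case: i => [//|i]); rewrite nth_default.
rewrite Es {Es}; apply: srun_seq.
  have := @srun_for B 0 (SPush 12 true ;; SPush 13 true ;; SPush 13 true ;; SPush 14 true ;; SPush
      14 true ;;
    SPush 15 true ;; SPush 15 true ;; SPush 10 true ;; SPush 10 true) (fun i v => st [:: v; [::]; [::];
    [::]; [::]; [::]; [::]; [::]; [::]; [::]; nseq i.*2 true; [::]; nseq i true; nseq i.*2 true;
        nseq i.*2 true;
    nseq i.*2 true; [::]; [::]; [::]; [::]; [::]]) n (false :: io1).
  rewrite {1}/enc_nat cat_rcons; apply=> // [i v v'|i lt_i]; first by rewrite upd_st.
  do 8!push_step.
  by apply: srun_push_eq; rewrite /= ?upd_st // size_nseq; lia.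
do 6!push_step.
rewrite /=; apply: srun_eq; first apply: (@srun_readnat _ _ _ _ m (false :: io)) => //=.
- by rewrite /io1 /enc_nat cat_rcons.
- by rewrite addn0.
by rewrite !upd_st /= cats0 /est /fregs /c !(addn1, addn2, addn3).
Qed.

(** Pushes go on top, so the output is assembled from its end: p, the votes, their number, the
    number of candidates. *)
Definition Finish :=
  SPush 0 false ;; ReadNat 15 0 ;; Move 8 0 ;; SPush 0 false ;; ReadNat 9 0 ;;
  SPush 0 false ;; ReadNat 10 0.

Lemma srun_finish qs : size (encv c qs) + size qs + n.*2.*2 + 9 <= B ->
  srun Finish (est [::] qs [::] (fregs (nseq n true) [::] [::] [::] [::] [::]))
   (st [:: enc_nat c ++ enc_seq (enc_seq enc_nat) (map (vote c) qs) ++ enc_nat (n.*2 + 2);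
     [::]; [::]; [::]; [::]; [::]; [::]; [::]; [::]; [::]; [::]; [::]; nseq n true; nseq n.*2 true;
     nseq (n.*2 + 1) true; [::]; [::]; [::]; [::]; [::]; [::]]).
Proof.
move=> sB.
apply: srun_seq; first by apply: srun_push => /=; lia.
rewrite upd_st /=; apply: srun_seq.
  apply: (@srun_readnat _ _ _ _ (n.*2 + 2) [::]) => //=; first by rewrite /st /= cats0.
  by lia.
rewrite !upd_st /= -[_ ++ [:: false]]/(nseq (n.*2 + 2) true ++ [:: false]) cats1 -/(enc_nat _).
apply: srun_seq; first apply: srun_move => //.
  by rewrite /= size_rev size_enc_nat; lia.
rewrite !upd_st /= revK.
apply: srun_seq; first by apply: srun_push; rewrite /= size_cat size_enc_nat; lia.
rewrite upd_st /=; apply: srun_seq.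
  apply: (@srun_readnat _ _ _ _ (size qs) [::]) => //=; first by rewrite /st /= cats0.
  by rewrite size_cat size_enc_nat; lia.
rewrite !upd_st /= -cat_rcons -/(enc_nat _).
apply: srun_seq; first by apply: srun_push; rewrite /= !size_cat !size_enc_nat; lia.
rewrite upd_st /=; apply: srun_eq.
  apply: (@srun_readnat _ _ _ _ c [::]) => //=; first by rewrite /st /= cats0.
  have Ec : c = n.*2 + 3 by []. 
  by rewrite !size_cat !size_enc_nat; move: (size (encv c qs)) sB Ec => e; lia.
rewrite !upd_st /= -cat_rcons -/(enc_nat _) /enc_seq size_map -!catA.
by [].
Qed.

Definition Reduce :=
  Init ;; SFor 18 Block ;; SFor 0 (Emit1 13 ;; Emit1 14) ;; Emit1 15 ;; Finish.

Lemma srun_reduce sets k : size sets <= B ->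
  let x := MkMkU n sets k in
  room (prefixes x) -> size (encv c (prefixes x)) + size (prefixes x) + n.*2.*2 + 9 <= B ->
  exists2 sg, srun Reduce (sinit (enc_mku x)) sg & sg 0 = enc_ccdc (ccdc_of_mku x).
Proof.
move=> mB x rm sB; pose m := size sets.
eexists.
  apply: srun_seq.
    rewrite /enc_mku {1}/enc_seq -catA; exact: (srun_init _ mB).
  apply: srun_seq.
    have := @srun_for B 18 Block (fun i v =>
      est (flatten (map (enc_seq enc_nat) (drop i sets)) ++ enc_nat k)
       (flatten (map (block n) (take i sets))) [::]
       (fregs (nseq n true) [::] [::] v [::] [::])) m [::].
    rewrite cats0 drop0 take0 /= drop_size take_size; apply=> // [i v v'|i lt_i].
      by rewrite upd_st.
    rewrite (drop_nth [::]) // (take_nth [::]) // map_rcons flatten_rcons /= -catA.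
    have rmi : room (flatten (map (block n) (take i sets)) ++ block n (nth [::] sets i)).
      rewrite -flatten_rcons -map_rcons -take_nth //; move: rm; rewrite /prefixes /= => /room_cat.
      by rewrite -{1}(cat_take_drop i.+1 sets) map_cat flatten_cat => /room_cat.
    apply: srun_block => //.
    have : okp c (rcons (nth [::] sets i) (n.*2 + 2)).
      by case/andP: rmi; rewrite all_cat => /andP[_ /andP[]].
    move=> /okp_vote[]; rewrite /vote size_cat size_rcons => sv _.
    apply: (@leq_trans c); first by rewrite -sv addSnnS leq_addr.
    by apply: leq_trans nB; rewrite /c leq_add2l.
  rewrite /=; apply: srun_seq.
    pose qs := flatten (map (block n) sets).
    pose W i := flatten (nseq i [:: [:: n.*2]; [:: n.*2 + 1]]).
    have WD i j : W (i + j) = W i ++ W j by rewrite /W nseqD flatten_cat.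
    have := @srun_for B 0 (Emit1 13 ;; Emit1 14) (fun i v =>
      est v (qs ++ W i) [::] (fregs (nseq n true) [::] [::] [::] [::] [::])) k [:: false].
    rewrite cats1 -/(enc_nat k) /= [qs ++ W 0]cats0; apply=> // [i v v'|i lt_i].
      by rewrite upd_st.
    have rmi : room (qs ++ W i.+1).
      move: rm; rewrite /x /prefixes /= -/qs -/(W k) -(subnKC lt_i) WD -(catA (W _)) catA.
      exact: room_cat.
    rewrite -addn1 WD (catA qs) in rmi *; set q0 := qs ++ W i in rmi *.
    have E2 : q0 ++ W 1 = rcons (rcons q0 [:: n.*2]) [:: n.*2 + 1] by rewrite -!cats1 -catA.
    rewrite E2 in rmi *; have rmi' := rmi; rewrite -cats1 in rmi'; have {}rmi' := room_cat rmi'.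
    apply: srun_seq; first by apply: (@srun_emit1 _ _ [::] _ _ _ _ _ rmi').
    by apply: (@srun_emit1 _ _ [::] _ _ _ _ _ rmi).
  rewrite /=; apply: srun_seq.
    apply: (@srun_emit1 _ _ [::] (n.*2 + 2)) => //.
    by rewrite -cats1 -catA.
  rewrite -cats1 -catA; exact: (@srun_finish (prefixes x)).
by [].
Qed.

End Program.

Lemma okp_prefixes x : mku_valid x -> all (okp ((mku_n x).*2 + 3)) (prefixes x).
Proof.
case: x => n sets k /and4P[/= _ valid _ _]; rewrite /prefixes /=.
have ok1 a : a < n.*2 + 3 -> okp (n.*2 + 3) [:: a] by rewrite /okp /= andbT.
rewrite !all_cat /= ok1 ?andbT; last lia.
apply/andP; split; last first.
  apply/allP => q /flattenP[qs /nseqP[-> _]]; rewrite !inE.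
  by case/orP=> /eqP->; apply: ok1; lia.
apply/allP => q /flattenP[qs /mapP[s ss ->]].
have /and3P[_ s_sorted s_lt] := allP valid _ ss.
rewrite mem_cat => /orP[|/flattenP[t /mapP[u]]].
  rewrite !inE => /or4P[/eqP->|/eqP->|/eqP->|/or3P[]/eqP->]; try by apply: ok1; lia.
  rewrite /okp rcons_uniq all_rcons (sorted_uniq ltn_trans ltnn s_sorted) andbT.
  apply/and3P; split; [|lia|].
    by apply/negP => /(allP s_lt); lia.
  by apply: sub_all s_lt => a; lia.
rewrite mem_iota => lt_u -> {t}; rewrite !inE /okp => /or3P[]/eqP-> /=; rewrite !inE; lia.
Qed.

Lemma size_prefixes x :
  size (prefixes x) = size (mku_sets x) * (3 * mku_n x + 6) + 2 * mku_k x + 1.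
Proof.
case: x => n sets k; rewrite /prefixes /= !size_cat /=.
have -> : size (flatten (map (block n) sets)) = size sets * (3 * n + 6).
  have size_block s : size (block n s) = 3 * n + 6.
    rewrite /block size_cat addnC; congr (_ + _).
    have G i : forall j, size (flatten [seq [:: [:: u; n.*2 + 1]; [:: n + u; n.*2 + 2];
        [:: n + u; n.*2]] | u <- iota j i]) = 3 * i by elim: i => //= i IHi j; rewrite IHi mulnS.
    exact: G.
  elim: sets => [//|s sets IHs].
  change (size (block n s ++ flatten (map (block n) sets)) = (size sets).+1 * (3 * n + 6)).
  by rewrite size_cat size_block IHs mulSn.
have -> : size (flatten (nseq k [:: [:: n.*2]; [:: n.*2 + 1]])) = 2 * k.
  by elim: k => //= k ->; rewrite mulnS.
by rewrite addnA.
Qed.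

Lemma size_enc_mku x : [/\ mku_n x < size (enc_mku x), size (mku_sets x) < size (enc_mku x)
  & mku_k x < size (enc_mku x)].
Proof.
by rewrite /enc_mku !size_cat !size_enc_nat; split; lia.
Qed.

Lemma ptime_reduce : ptime_computable enc_mku enc_ccdc (fun x => mku_valid x) ccdc_of_mku.
Proof.
(* [J N] bounds the number of votes according to [size_prefixes]. In [F], [2 * N + 4] bounds the
   number of candidates plus one, and the last summand is for [Finish]. *)
pose J N := N * (3 * N + 6) + 2 * N + 1.
pose F N := (J N).+1 * ((2 * N + 4) * (2 * N + 4)) + (J N + 4 * N + 9).
apply: (@sprog_ptime _ _ _ _ _ _ 21 Reduce F) => //.
  have PJ : ispoly J by rewrite /J; repeat first [apply: ispoly_id | apply: ispolyD | apply:
      ispolyM | apply: ispoly_const].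
  apply: (ispoly_le (G := fun N => (J N + 1) * ((2 * N + 4) * (2 * N + 4)) + (J N + 4 * N + 9))).
    by move=> N; rewrite addn1.
  by repeat first [apply: PJ | apply: ispoly_id | apply: ispolyD | apply: ispolyM | apply:
      ispoly_const].
move=> x vx; have [lt_n lt_m lt_k] := size_enc_mku x; set N := size (enc_mku x) in lt_n lt_m lt_k *.
have sJ : size (prefixes x) <= J N by rewrite size_prefixes /J; nia.
have ok := okp_prefixes vx.
have NF : N <= F N by rewrite /F; lia.
split=> //; case: x vx @N lt_n lt_m lt_k sJ ok NF => n sets k vx N /= lt_n lt_m lt_k sJ ok NF.
have le_c : (n.*2 + 3).+1 * (n.*2 + 3).+1 <= (2 * N + 4) * (2 * N + 4) by apply: leq_mul; lia.
apply: (@srun_reduce (F N) (J N) n).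
- by rewrite /F; apply: leq_trans (leq_addr _ _); rewrite leq_mul2l le_c orbT.
- exact: leq_trans (ltnW lt_m) NF.
- by rewrite /room ok.
- have := size_encv ok; rewrite /F; move: sJ le_c.
  set X := (2 * N + 4) * _; set Y := _.+1 * _.+1; set K := size (prefixes _) => sJ le_c le_e.
  have : K * Y <= J N * X by apply: leq_mul.
  by rewrite mulSn; lia.
Qed.

(** * The backward map and its program *)

Definition covered (y s : seq nat) : bool := all (fun u => u \in y) s.

Definition choose_sets (x : mku_inst) (y : seq nat) : seq nat :=
  let cov i := covered y (nth [::] (mku_sets x) i) in
  let idx := iota 0 (size (mku_sets x)) in
  take (mku_k x) (filter cov idx ++ filter (predC cov) idx).

Section Program.
Variables (B : nat) (y : seq nat).
Hypothesis (yB : size (encs y) <= B).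

Local Notation srun := (sexec B).

(** Registers 8 and 9 collect the covered and the uncovered indices, 11 is the current index, and 12
    counts the elements of the current set outside [y]. Registers 15 and 16 keep the sets, reversed
    and in order, 17 the two index lists joined, and 13 and 18 the number of sets. *)
Definition gst io a l3 ys fl co uo k i bad m l sr s t m2 : store :=
  st [:: io; a; ys; l3; [::]; [::]; [::]; fl; co; uo; k; i; bad; m; l; sr; s; t; m2].

(** The sets come before the solution in the input, so they are put aside until the solution can be
    read. *)
Definition SaveSet :=
  SFor 0 (SPush 14 true ;; SPush 15 true) ;; SPush 15 false ;; SFor 14 (ShiftNat 0 15).

Lemma srun_save_set io a l3 ys fl co uo k i bad m sr s' t m2 s :
  size sr + size (enc_seq enc_nat s) <= B ->
  srun SaveSet
   (gst (enc_seq enc_nat s ++ io) a l3 ys fl co uo k i bad m [::] sr s' t m2)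
   (gst io a l3 ys fl co uo k i bad m [::] (rev (enc_seq enc_nat s) ++ sr) s' t m2).
Proof.
rewrite {1}/enc_seq size_cat size_enc_nat -/(encs s) => sB; apply: srun_seq.
  have := @srun_for B 0 (SPush 14 true ;; SPush 15 true) (fun j v =>
    gst v a l3 ys fl co uo k i bad m (nseq j true) (nseq j true ++ sr) s' t m2) (size s)
    (false :: encs s ++ io).
  rewrite -cat_rcons -/(enc_nat _) catA /=; apply=> // [j v v'|j lt_j]; first by rewrite upd_st.
  apply: srun_seq; first by apply: srun_push; rewrite /= size_nseq; lia.
  by rewrite upd_st /=; apply: srun_push_eq; rewrite /= ?upd_st // size_cat size_nseq; lia.
rewrite /=; apply: srun_seq.
  by apply: srun_push; rewrite /= size_cat size_nseq; lia.
have E0 : false :: nseq (size s) true = rev (enc_nat (size s)) by rewrite /enc_nat rev_rcons rev_nseq.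
rewrite upd_st /= -cat_cons E0.
have := @srun_for B 14 (ShiftNat 0 15) (fun j v =>
    gst (encs (drop j s) ++ io) a l3 ys fl co uo k i bad m v
      (rev (encs (take j s)) ++ rev (enc_nat (size s)) ++ sr) s' t m2) (size s) [::].
rewrite drop0 take0 take_size drop_size cats0 /= catA -rev_cat.
apply=> // [j v v'|j lt_j]; first by rewrite upd_st.
have Es := congr1 (size \o encs) (cat_take_drop j.+1 s).
rewrite /= encs_cat (take_nth 0) // encs_rcons !size_cat size_enc_nat in Es.
rewrite (take_nth 0) // encs_rcons rev_cat -catA.
apply: srun_eq; first apply: (@srun_shiftnat _ _ _ _ (nth 0 s j) (encs (drop j.+1 s) ++ io)) => //.
- by rewrite /= (drop_nth 0) // encs_cons /enc_nat cat_rcons -catA.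
- by rewrite /= !size_cat !size_rev size_enc_nat; lia.
by rewrite !upd_st.
Qed.

Definition CheckSet :=
  ReadNat 16 14 ;;
  SFor 14 (ReadNat 16 1 ;; Member ;; SCase 7 (SPush 12 true) SSkip SSkip ;; Clear 1) ;;
  SCase 12 (App 8 5 11) SSkip (Clear 12 ;; App 9 5 11) ;; SPush 11 true.

Lemma srun_check_set io co uo k i m s s' t m2 :
  size s <= B -> size (encs s) <= B -> i < B -> size co + size uo + i.+1 <= B ->
  srun CheckSet
   (gst io [::] [::] (encs y) [::] co uo k (nseq i true) [::] m [::] [::] (enc_seq enc_nat s ++ s')
       t m2)
   (gst io [::] [::] (encs y) [::]
      (if covered y s then rev (enc_nat i) ++ co else co)
      (if covered y s then uo else rev (enc_nat i) ++ uo)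
      k (nseq i.+1 true) [::] m [::] [::] s' t m2).
Proof.
move=> sB esB iB cB; apply: srun_seq.
  apply: (@srun_readnat _ _ _ _ (size s) (false :: encs s ++ s')) => //=; last by rewrite addn0.
  by rewrite /gst /st /= /enc_seq /enc_nat -catA cat_rcons.
rewrite !upd_st /= cats0; apply: srun_seq.
  pose bad j := nseq (count (fun u => u \notin y) (take j s)) true.
  have := @srun_for B 14 (ReadNat 16 1 ;; Member ;; SCase 7 (SPush 12 true) SSkip SSkip ;; Clear 1)
      (fun j v =>
    gst io [::] [::] (encs y) [::] co uo k (nseq i true) (bad j) m v
      [::] (encs (drop j s) ++ s') t m2) (size s) [::].
  rewrite drop0 cats0 [bad 0]/bad take0 /=; apply=> // [j v v'|j lt_j]; first by rewrite upd_st.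
  set v := nseq (size s - j.+1) true ++ [::].
  have lt_u : (nth 0 s j).+1 <= size (encs s).
    have := congr1 (size \o encs) (cat_take_drop j.+1 s).
    by rewrite /= encs_cat (take_nth 0) // encs_rcons !size_cat size_enc_nat; lia.
  apply: srun_seq.
    apply: (@srun_readnat _ _ _ _ (nth 0 s j) (false :: encs (drop j.+1 s) ++ s')) => //=.
      by rewrite /gst /st /= (drop_nth 0) // encs_cons -catA.
    by rewrite addn0; lia.
  rewrite !upd_st /= cats0; apply: srun_seq; first by apply: srun_mem => //; lia.
  apply: (@srun_seq _ _ _ _ (gst io (nseq (nth 0 s j) true) [::] (encs y) [::] co uo k (nseq i true)
    (bad j.+1) m v [::] (encs (drop j.+1 s) ++ s') t m2)); last first.
    by apply: srun_eq; first exact: srun_clear; rewrite upd_st.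
  have Eb : bad j.+1 = nseq (nth 0 s j \notin y) true ++ bad j.
    by rewrite /bad (take_nth 0) // -cats1 count_cat /= addn0 nseq_cat_true addnC.
  rewrite Eb; case: (boolP (nth 0 s j \in y)) => yj /=.
    apply: (@srun_case_cons _ _ _ _ _ true [::]) => //.
    by rewrite upd_st; apply: srun_skip.
  apply: srun_case_nil => //; apply: srun_push_eq; last by rewrite upd_st.
  rewrite /= size_nseq; apply: leq_ltn_trans (count_size _ _) _.
  by rewrite size_take lt_j; apply: leq_trans sB.
rewrite /= take_size drop_size /=.
have Ecov : covered y s = (count (fun u => u \notin y) s == 0).
  rewrite /covered -[RHS]negbK -lt0n -has_count -all_predC.
  by apply: eq_all => u /=; rewrite negbK.
apply: (@srun_seq _ _ _ _ (gst io [::] [::] (encs y) [::]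
      (if covered y s then rev (enc_nat i) ++ co else co)
      (if covered y s then uo else rev (enc_nat i) ++ uo)
      k (nseq i true) [::] m [::] [::] s' t m2)); last first.
  by apply: srun_push_eq; rewrite ?upd_st //= size_nseq.
case: (posnP (count (fun u => u \notin y) s)) Ecov => [->|c0] ->.
  apply: srun_case_nil => //; apply: srun_eq; first apply: (@srun_app _ _ _ _ _ i) => //=.
  - exact: ltnW.
  - by rewrite /gst /st /=; lia.
  by rewrite upd_st.
apply: (@srun_case_cons _ _ _ _ _ true
   (nseq (count (fun u => u \notin y) s).-1 true)).
  by rewrite /gst /st /=; apply: nseq_trueS; rewrite prednK.
rewrite upd_st /=; apply: srun_seq; first exact: srun_clear.
rewrite upd_st /=; apply: srun_eq; first apply: (@srun_app _ _ _ _ _ i) => //=.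
- exact: ltnW.
- by lia.
by rewrite upd_st.
Qed.

Definition Solve :=
  SkipNat 0 ;; ReadNat 0 13 ;; SFor 13 (SPush 18 true ;; SaveSet) ;;
  ReadNat 0 10 ;; SkipNat 0 ;; Move 0 3 ;; Move 3 2 ;; Move 15 16 ;;
  SFor 18 CheckSet ;; Move 9 17 ;; Move 8 17 ;; App 15 5 10 ;; SFor 10 (ShiftNat 17 15) ;; Move 15 0.

Lemma srun_solve x : let m := size (mku_sets x) in
  mku_k x <= m -> size (enc_mku x) < B -> m * m + mku_k x + 1 <= B ->
  exists2 sg, srun Solve (sinit (enc_mku_sol (x, y))) sg & sg 0 = enc_sol (choose_sets x y).
Proof.
case: x => n sets k m /= km xB mB.
pose E := flatten (map (enc_seq enc_nat) sets).
have Ex : enc_mku (MkMkU n sets k) = enc_nat n ++ enc_nat m ++ E ++ enc_nat k.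
  by rewrite /enc_mku /= /enc_seq -!catA.
have := xB; rewrite Ex !size_cat !size_enc_nat => sB.
pose cov i := covered y (nth [::] sets i).
pose co i := filter cov (iota 0 i); pose uo i := filter (predC cov) (iota 0 i).
(* The two lists split the indices below [i], and the code of an index below [m] has at most [m]
   bits. *)
have cuB i : i <= m -> size (encs (co i)) + size (encs (uo i)) <= i * m.
  move=> im; have lt_m p : all (fun a => a < m) (filter p (iota 0 i)).
    by apply/allP => a; rewrite mem_filter mem_iota => /andP[_ /=]; lia.
  apply: leq_trans (leq_add (size_encs_le (lt_m _)) (size_encs_le (lt_m _))) _.
  by rewrite -mulnDl !size_filter count_predC size_iota.
have coS i : co i.+1 = co i ++ (if cov i then [:: i] else [::]).
  by rewrite /co -addn1 iotaD filter_cat add0n /=.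
have uoS i : uo i.+1 = uo i ++ (if cov i then [::] else [:: i]).
  by rewrite /uo -addn1 iotaD filter_cat add0n /=; case: (cov i).
have Es : sinit (enc_mku_sol (MkMkU n sets k, y)) =
    gst (enc_nat n ++ enc_nat m ++ E ++ enc_nat k ++ enc_nat (size y) ++ encs y)
     [::] [::] [::] [::] [::] [::] [::] [::] [::] [::] [::] [::] [::] [::] [::].
  apply: functional_extensionality => i; rewrite /sinit /upd /gst /st.
  rewrite /enc_mku_sol Ex -!catA.
  by do 19!(case: i => [//|i]); rewrite nth_default.
have sm : size (co m ++ uo m) = m by rewrite size_cat !size_filter count_predC size_iota.
rewrite Es {Es}; eexists.
  apply: srun_seq; first apply: (@srun_skipnat _ _ _ n (false :: _)) => //.
    by rewrite /gst /st /= {1}/enc_nat cat_rcons.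
  rewrite upd_st /=.
  apply: srun_seq; first apply: (@srun_readnat _ _ _ _ m (false :: _)) => //.
  - by rewrite /gst /st /= {1}/enc_nat cat_rcons.
  - by rewrite /= addn0; lia.
  rewrite !upd_st /= cats0.
  pose tl := enc_nat k ++ enc_nat (size y) ++ encs y; rewrite -/tl.
  apply: srun_seq.
    have := @srun_for B 13 (SPush 18 true ;; SaveSet) (fun i v =>
      gst (flatten (map (enc_seq enc_nat) (drop i sets)) ++ tl)
        [::] [::] [::] [::] [::] [::] [::] [::] [::] v [::]
        (rev (flatten (map (enc_seq enc_nat) (take i sets)))) [::] [::] (nseq i true)) m [::].
    rewrite cats0 drop0 take0 /= drop_size take_size; apply=> // [i v v'|i lt_i].
      by rewrite upd_st.
    have Et := congr1 (fun l => size (flatten (map (enc_seq enc_nat) l))) (cat_take_drop i.+1 sets).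
    rewrite map_cat flatten_cat size_cat -/E in Et.
    rewrite (take_nth [::]) // map_rcons flatten_rcons size_cat in Et.
    rewrite (drop_nth [::]) // (take_nth [::]) // map_rcons flatten_rcons /= -catA.
    apply: srun_seq; first by apply: srun_push; rewrite /= size_nseq; lia.
    rewrite upd_st /= rev_cat; apply: srun_save_set.
    by rewrite size_rev; lia.
  rewrite /= -/E.
  apply: srun_seq; first apply: (@srun_readnat _ _ _ _ k (false :: _)) => //.
  - by rewrite /gst /st /= /tl {1}/enc_nat cat_rcons.
  - by rewrite /= addn0; lia.
  rewrite !upd_st /= cats0.
  apply: srun_seq; first apply: (@srun_skipnat _ _ _ (size y) (false :: encs y)) => //.
    by rewrite /gst /st /= {1}/enc_nat cat_rcons.
  rewrite upd_st /=.
  apply: srun_seq; first by apply: srun_move => //=; lia.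
  rewrite !upd_st /=.
  apply: srun_seq; first by apply: srun_move => //=; rewrite cats0 size_rev; lia.
  rewrite !upd_st /= !cats0 revK.
  apply: srun_seq; first by apply: srun_move => //=; rewrite size_rev; lia.
  rewrite !upd_st /= !cats0 revK.
  apply: srun_seq.
    have := @srun_for B 18 CheckSet (fun i v =>
      gst [::] [::] [::] (encs y) [::] (rev (encs (co i))) (rev (encs (uo i))) (nseq k true) (nseq
          i true)
       [::] [::] [::] [::] (flatten (map (enc_seq enc_nat) (drop i sets))) [::] v) m [::].
    rewrite cats0 drop0 /= drop_size; apply=> // [i v v'|i lt_i].
      by rewrite upd_st.
    have Et := congr1 (fun l => size (flatten (map (enc_seq enc_nat) l))) (cat_take_drop i sets).
    rewrite map_cat flatten_cat size_cat -/E (drop_nth [::]) //= size_cat in Et.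
    rewrite {2}/enc_seq size_cat size_enc_nat -/(encs _) in Et.
    rewrite (drop_nth [::]) //= coS uoS !encs_cat !rev_cat.
    have H := @srun_check_set [::] (rev (encs (co i))) (rev (encs (uo i))) (nseq k true) i [::]
      (nth [::] sets i) (flatten (map (enc_seq enc_nat) (drop i.+1 sets))) [::] (nseq (m - i.+1)
          true ++ [::]).
    rewrite -/(cov i) !size_rev in H.
    have cuBi := cuB i (ltnW lt_i); have im := leq_mul (ltnW lt_i) (leqnn m).
    apply: srun_eq; first by apply: H; try lia; apply: leq_trans mB; nia.
    by case: (cov i); rewrite encs1.
  rewrite /=; have cuBm := cuB m (leqnn m).
  apply: srun_seq; first by apply: srun_move => //=; rewrite size_rev; lia.
  rewrite !upd_st /= revK cats0.
  apply: srun_seq; first by apply: srun_move => //=; rewrite size_rev; lia.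
  rewrite !upd_st /= revK -encs_cat.
  apply: srun_seq; first by apply: (@srun_app _ _ _ _ _ k) => //=; lia.
  rewrite !upd_st /= cats0.
  apply: srun_seq.
    have := @srun_for B 10 (ShiftNat 17 15) (fun i v =>
      gst [::] [::] [::] (encs y) [::] [::] [::] v (nseq m true)
       [::] [::] [::] (rev (encs (take i (co m ++ uo m))) ++ rev (enc_nat k)) [::]
       (encs (drop i (co m ++ uo m))) [::]) k [::].
    rewrite drop0 take0 cats0 /=; apply=> // [i v v'|i lt_i]; first by rewrite upd_st.
    have Et := congr1 (size \o encs) (cat_take_drop i.+1 (co m ++ uo m)).
    have lt_im : i < size (co m ++ uo m) by rewrite sm; apply: leq_trans km.
    rewrite /= [in RHS]encs_cat encs_cat (take_nth 0) // encs_rcons !size_cat size_enc_nat in Et.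
    rewrite (take_nth 0) // encs_rcons rev_cat -catA.
    apply: srun_eq; first apply: (@srun_shiftnat _ _ _ _ (nth 0 (co m ++ uo m) i) (encs (drop i.+1
        (co m ++ uo m)))) => //.
    - by rewrite /= (drop_nth 0) // encs_cons /enc_nat cat_rcons.
    - by rewrite /= !size_cat !size_rev size_enc_nat; lia.
    by rewrite !upd_st.
  rewrite /= -rev_cat; apply: srun_move => //=.
  have Et := congr1 (size \o encs) (cat_take_drop k (co m ++ uo m)).
  rewrite /= [in RHS]encs_cat encs_cat !size_cat in Et.
  by rewrite size_rev size_cat size_enc_nat; lia.
rewrite /upd /= revK cats0 /enc_sol /enc_seq -[choose_sets _ _]/(take k (co m ++ uo m)).
have sk : size (take k (co m ++ uo m)) = k by apply: size_takel; rewrite sm.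
by rewrite sk.
Qed.

End Program.

Lemma ptime_solve (P : mku_inst * seq nat -> Prop) : (forall xy, P xy -> mku_valid xy.1) ->
  ptime_computable enc_mku_sol enc_sol P (fun xy => choose_sets xy.1 xy.2).
Proof.
move=> HP; pose F N := N * N + N + 1 + N.
apply: (@sprog_ptime _ _ _ _ _ _ 19 Solve F) => //.
  by rewrite /F; repeat first [apply: ispoly_id | apply: ispolyD | apply: ispolyM | apply:
      ispoly_const].
move=> [x y] /HP /= /and4P[_ _ _ km]; have [_ lt_m lt_k] := size_enc_mku x.
set N := size _; have sN : size (enc_mku x) + size (encs y) + 1 <= N.
  have -> : N = size (enc_mku x ++ enc_nat (size y) ++ encs y) by [].
  by move: (enc_mku x) => e; rewrite !size_cat size_enc_nat; lia.
split; first by rewrite /F; lia.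
apply: srun_solve => //; rewrite /F; try lia.
have : size (mku_sets x) * size (mku_sets x) <= N * N by apply: leq_mul; lia.
by lia.
Qed.

(** * Correctness of the reduction *)

Section Election.
Variables (n : nat) (y : seq nat).
Let c := n.*2 + 3.
Let p := n.*2 + 2.
Let w := n.*2.
Let z := n.*2 + 1.
Hypothesis py : p \notin y.

(* Falling back on the natural order of all candidates, deleted prefix included, does not change
   who heads the vote. *)
Definition top (q : seq nat) := ohead [seq b <- q ++ iota 0 c | b \notin y].

Lemma top_cons a q : top (a :: q) = if a \in y then top q else Some a.
Proof. by rewrite /top /=; case: (a \in y). Qed.

(** As p is never deleted, the vote reaches p once all of [s] is gone; the other disjunct is for an
    [s] that contains p, which [p_notin] excludes for the sets of the instance. *)
Lemma top_rcons s : exists2 b, top (rcons s p) = Some b & (b == p) = (all (mem y) s) || (b == p) &&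
    (p \in s).
Proof.
elim: s => [|a s [b Hb Eb]]; first by exists p; rewrite ?eqxx // top_cons (negbTE py).
rewrite /= top_cons inE; case: (boolP (a \in y)) => ay /=.
  exists b => //; case: (p =P a) => [Ea|_]; last exact: Eb.
  by move: py; rewrite Ea ay.
by exists a => //; rewrite eq_sym; case: eqP.
Qed.

Lemma ohead_filter_cat (T : Type) (P : pred T) (s t : seq T) :
  ohead (filter P (s ++ t)) = if has P s then ohead (filter P s) else ohead (filter P t).
Proof. by elim: s => //= a s IHs; case: (P a). Qed.

Lemma vote_top q : ohead [seq b <- vote c q | b \notin y] = top q.
Proof.
rewrite /top /vote !ohead_filter_cat; case: ifP => // /hasPn qy.
rewrite -filter_predI; congr ohead; apply: eq_filter => b /=.
case: (boolP (b \in q)) => [/qy|]; last by rewrite andbT.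
by rewrite negbK => ->.
Qed.

Lemma top_mem q a b : b \in q -> b \notin y -> top q = Some a -> a \in q.
Proof.
move=> bq b_y; rewrite /top ohead_filter_cat; have -> : has (fun b => b \notin y) q by apply/hasP;
    exists b.
case E: [seq _ <- _ | _] => [//|d l] [<-].
have : d \in [seq b <- q | b \notin y] by rewrite E mem_head.
by rewrite mem_filter => /andP[].
Qed.

(** Votes whose prefix is deleted fall to [top [::]], the first remaining candidate. Since p is last
    in the natural order, this is p only when all the others are deleted. *)
Lemma control_cases :
  (exists2 r, top [::] = Some r & r != p) \/ (forall a, a < n.*2 + 2 -> a \in y).
Proof.
have Ei : iota 0 c = iota 0 (n.*2 + 2) ++ [:: p] by rewrite (_ : c = n.*2 + 2 + 1) ?iotaD // /c -addnA.
case: (boolP (has (fun b => b \notin y) (iota 0 (n.*2 + 2)))) => H; last first.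
  right => a ac; move/hasPn: H => /(_ a); rewrite mem_iota => /(_ ac).
  by rewrite negbK.
left; rewrite /top Ei /= ohead_filter_cat H.
case E: [seq _ <- _ | _] => [|r l]; first by move: H; rewrite has_filter E.
exists r => //; have : r \in [seq b <- iota 0 (n.*2 + 2) | b \notin y] by rewrite E mem_head.
by rewrite mem_filter mem_iota /p => /andP[_]; lia.
Qed.

Variables (sets : seq (seq nat)) (k : nat).
Let x := MkMkU n sets k.
Let m := size sets.

Definition tops (q : nat -> seq nat) (a : nat) : nat :=
  count (fun u => top (q u) == Some a) (iota 0 n).

Lemma score_eq a : plurality_score (cc_votes (ccdc_of_mku x)) y a =
  count (fun s => top (rcons s p) == Some a) sets +
  m * (2 * (top [:: p] == Some a) + 2 * (top [:: w] == Some a) + (top [:: z] == Some a) +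
    (tops (fun u => [:: u; z]) a + tops (fun u => [:: n + u; p]) a + tops (fun u => [:: n + u; w]) a)) +
  (k * ((top [:: w] == Some a) + (top [:: z] == Some a)) + (top [:: p] == Some a)).
Proof.
rewrite /plurality_score /= count_map (eq_count (a2 := fun q => top q == Some a)); last first.
  by move=> q /=; rewrite vote_top.
rewrite /prefixes /= !count_cat /= addn0; congr (_ + (_ + _)).
  have Eb s : count (fun q => top q == Some a) (block n s) = (top (rcons s p) == Some a) +
    (2 * (top [:: p] == Some a) + 2 * (top [:: w] == Some a) + (top [:: z] == Some a) +
    (tops (fun u => [:: u; z]) a + tops (fun u => [:: n + u; p]) a + tops (fun u => [:: n + u; w]) a)).
    rewrite /block count_cat /= -/p -/w -/z.
    have -> : count (fun q => top q == Some a)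
        (flatten [seq [:: [:: u; z]; [:: n + u; p]; [:: n + u; w]] | u <- iota 0 n]) =
       tops (fun u => [:: u; z]) a + tops (fun u => [:: n + u; p]) a + tops (fun u => [:: n + u; w]) a.
      rewrite /tops; elim: (iota 0 n) => //= u l ->; lia.
    lia.
  rewrite /m; elim: sets => [//|s l IHl].
  change (flatten (map (block n) (s :: l))) with (block n s ++ flatten (map (block n) l)).
  by rewrite count_cat IHl Eb /= [(size l).+1 * _]mulSn addnACA.
by elim: k => //= j ->; rewrite mulSn addnA.
Qed.

(** [out1] and [out2] are the numbers of deleted elements and deleted partners. *)
Definition out1 := count (mem y) (iota 0 n).
Definition out2 := count (fun u => n + u \in y) (iota 0 n).

Hypothesis lt_sets : all (all (fun u => u < n)) sets.

Lemma p_notin s : s \in sets -> p \notin s.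
Proof. by move=> /(allP lt_sets) /allP lt_s; apply/negP => /lt_s; rewrite /p; lia. Qed.

Lemma score_p : top [:: w] != Some p -> top [:: z] != Some p ->
  plurality_score (cc_votes (ccdc_of_mku x)) y p =
  count (covered y) sets + m * (2 + out2) + 1.
Proof.
move=> wp zp; rewrite score_eq (negbTE wp) (negbTE zp).
have -> : top [:: p] == Some p by rewrite top_cons (negbTE py).
have -> : count (fun s => top (rcons s p) == Some p) sets = count (covered y) sets.
  apply: eq_in_count => s ss; have [b -> /=] := top_rcons s.
  by rewrite (negbTE (p_notin ss)) andbF orbF -[RHS]/(all (mem y) s) => <-.
have -> : tops (fun u => [:: u; z]) p = 0.
  apply/eqP; rewrite -leqn0 leqNgt -has_count; apply/hasPn => u; rewrite mem_iota top_cons.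
  by move=> ltu; case: ifP => // _; rewrite -[_ == _]/(u == p) /p; apply/eqP; lia.
have -> : tops (fun u => [:: n + u; w]) p = 0.
  apply/eqP; rewrite -leqn0 leqNgt -has_count; apply/hasPn => u; rewrite mem_iota top_cons.
  by move=> ltu; case: ifP => // _; rewrite -[_ == _]/(n + u == p) /p; apply/eqP; lia.
have -> : tops (fun u => [:: n + u; p]) p = out2.
  apply: eq_in_count => u; rewrite mem_iota => ltu.
  rewrite !top_cons (negbTE py); case: (_ \in y); first by rewrite eqxx.
  by rewrite -[_ == _]/(n + u == p) /p; apply/eqP; lia.
by rewrite /=; lia.
Qed.

Section Control.
Hypothesis k0 : 0 < k.
Hypothesis win : unique_plurality_winner (ccdc_of_mku x) y.

Lemma beaten a : a < c -> a \notin y -> a != p ->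
  plurality_score (cc_votes (ccdc_of_mku x)) y a < plurality_score (cc_votes (ccdc_of_mku x)) y p.
Proof.
move=> ac ay ap; have := allP win a; rewrite mem_iota /= => /(_ ac).
by rewrite (negbTE ay) -/p (negbTE ap).
Qed.

Lemma top_some q a : top q = Some a -> all (fun b => b < c) q -> a < c /\ a \notin y.
Proof.
rewrite /top => E qc; have : a \in [seq b <- q ++ iota 0 c | b \notin y].
  by case: [seq _ <- _ | _] E => //= b l [->]; rewrite mem_head.
rewrite mem_filter mem_cat mem_iota => /andP[ay /orP[/(allP qc)|/andP[_]]] //.
Qed.

(** If w is deleted, its votes fall to one remaining candidate [aw] other than p, which must be
    beaten just as w would be; likewise [az] for z. So the two inequalities hold whether or not the
    rivals are deleted. *)
Lemma control_bound : (exists2 r, top [::] = Some r & r != p) ->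
  k <= count (covered y) sets /\ out1 <= out2.+1.
Proof.
case=> r Er rp.
have top1 b : b != p -> exists2 a, top [:: b] = Some a & a != p.
  by move=> bp; rewrite top_cons; case: ifP => _; [exists r|exists b].
have [aw Ew wp] : exists2 a, top [:: w] = Some a & a != p by apply: top1; rewrite /w /p; lia.
have [az Ez zp] : exists2 a, top [:: z] = Some a & a != p by apply: top1; rewrite /z /p; lia.
have := score_p; rewrite Ew Ez => /(_ wp zp) Sp.
have [|awc awy] := top_some Ew; first by rewrite /= /w /c; lia.
have [|azc azy] := top_some Ez; first by rewrite /= /z /c; lia.
have Lw : m * (2 + out2) + k <= plurality_score (cc_votes (ccdc_of_mku x)) y aw.
  rewrite score_eq Ew eqxx.
  have : out2 <= tops (fun u => [:: n + u; w]) aw.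
    by apply: sub_count => u /= uy; rewrite top_cons uy Ew.
  set o := tops _ aw => le_o.
  have := leq_mul (leqnn m) le_o; rewrite !mulnDr /=; lia.
have Lz : m * (1 + out1) + k <= plurality_score (cc_votes (ccdc_of_mku x)) y az.
  rewrite score_eq Ez eqxx.
  have : out1 <= tops (fun u => [:: u; z]) az.
    by apply: sub_count => u /= uy; rewrite top_cons uy Ez.
  set o := tops (fun u => [:: u; z]) az => le_o.
  have := leq_mul (leqnn m) le_o; rewrite !mulnDr /=; lia.
have := beaten awc awy wp; have := beaten azc azy zp; rewrite Sp => Hz Hw.
have cov_m : count (covered y) sets <= m by apply: count_size.
split; first by move: Hw Lw; lia.
(* Two more elements than partners would give [az] at least [m * (3 + out2) + k] points, while p has
   at most [m * (3 + out2) + 1] because at most [m] sets are covered; this contradicts [0 < k]. *)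
rewrite leqNgt; apply/negP => lt_o.
have := leq_mul (leqnn m) lt_o; move: Hz Lz; rewrite !mulnDr !mulnS; lia.
Qed.

End Control.

End Election.

Lemma size_outs n y : out1 n y + out2 n y <= size y.
Proof.
rewrite /out1 /out2 -!size_filter -(size_map (addn n)) -size_cat; apply: uniq_leq_size.
  rewrite cat_uniq filter_uniq ?iota_uniq // map_inj_uniq; last exact: addnI.
  rewrite filter_uniq ?iota_uniq // andbT /=; apply/hasPn => _ /mapP[u _ ->] /=.
  by rewrite mem_filter mem_iota; apply/negP => /andP[_]; lia.
move=> u; rewrite mem_cat mem_filter => /orP[/andP[]//|/mapP[v]].
by rewrite mem_filter => /andP[vy _ ->].
Qed.

Lemma mku_feasible_choose x y : mku_valid x -> mku_feasible x (choose_sets x y).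
Proof.
case: x => n sets k /and4P[_ _ _ /= km]; rewrite /mku_feasible /choose_sets /=.
set cov := fun i => covered y (nth [::] sets i); set l := _ ++ _.
have pl : perm_eq l (iota 0 (size sets)) by rewrite /l perm_filterC.
apply/and3P; split.
- by apply: take_uniq; rewrite (perm_uniq pl) iota_uniq.
- by apply/allP => i /mem_take; rewrite (perm_mem pl) mem_iota.
- by rewrite size_takel // (perm_size pl) size_iota.
Qed.

Lemma mku_measure_le x y l : mku_valid x -> 
  (forall i u, i \in y -> u \in nth [::] (mku_sets x) i -> u < mku_n x -> u \in l) ->
  mku_measure x y <= size l.
Proof.
case: x => n sets k /and4P[_ /= valid _ _] H; apply: uniq_leq_size; first exact: undup_uniq.
move=> u; rewrite mem_undup => /flattenP[s /mapP[i iy ->] us]; apply: (H i) => //.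
have lt_i : i < size sets by rewrite ltnNge; apply/negP => /(nth_default [::]) E; rewrite E in us.
by have /and3P[_ _ /allP] := allP valid _ (mem_nth [::] lt_i); apply.
Qed.

Lemma all_lt_sets x : mku_valid x -> all (all (fun u => u < mku_n x)) (mku_sets x).
Proof. by case/and4P => _ valid _ _; apply: sub_all valid => s /and3P[]. Qed.

(** If a candidate other than p remains, at least [k] sets are covered, so the chosen ones lie
    inside the deleted elements; their union has at most [out1] elements, and
    [2 * out1 <= out1 + out2 + 1]. Otherwise at least [2n + 2] candidates are deleted, while no
    union exceeds [n]. *)
Lemma choose_measure x y : mku_valid x -> 0 < mku_k x -> ccdc_feasible (ccdc_of_mku x) y ->
  2 * mku_measure x (choose_sets x y) <= (size y).+1.
Proof.
case: x => n sets k vx /= k0 /and4P[uy yc py win].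
have lt_sets := all_lt_sets vx; have /and4P[_ _ _ /= km] := vx.
rewrite /= in yc py; have [H|H] := control_cases py.
  have [cov_k le_out] := control_bound py lt_sets k0 win H.
  have : mku_measure (MkMkU n sets k) (choose_sets (MkMkU n sets k) y) <= out1 n y.
    rewrite /out1 -size_filter; apply: mku_measure_le => // i u /=.
    rewrite /choose_sets /= take_cat.
    set cov := fun i => covered y (nth [::] sets i).
    have Ecount : count cov (iota 0 (size sets)) = count (covered y) sets.
      by rewrite -[in RHS](mkseq_nth [::] sets) count_map.
    have -> : size [seq i <- iota 0 (size sets) | cov i] = count (covered y) sets.
      by rewrite size_filter Ecount.
    have -> : (if k < count (covered y) sets then take k [seq i <- iota 0 (size sets) | cov i] else
       [seq i <- iota 0 (size sets) | cov i] ++ take (k - count (covered y) sets)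
          [seq i <- iota 0 (size sets) | predC cov i]) = take k [seq i <- iota 0 (size sets) | cov i].
      case: ltnP => // le_c; have -> : k - count (covered y) sets = 0 by apply/eqP; rewrite subn_eq0.
      rewrite take0 cats0 take_oversize // size_filter.
      by rewrite Ecount.
    move=> /mem_take; rewrite mem_filter => /andP[/allP covi _] ui un.
    by rewrite mem_filter mem_iota /= add0n un andbT; apply: covi.
  by have := size_outs n y; lia.
have : mku_measure (MkMkU n sets k) (choose_sets (MkMkU n sets k) y) <= size (iota 0 n).
  by apply: mku_measure_le => // i u _ _ /= un; rewrite mem_iota.
have : size (iota 0 (n.*2 + 2)) <= size y.
  by apply: uniq_leq_size; [exact: iota_uniq|move=> a; rewrite mem_iota => /= /H].
by rewrite !size_iota; lia.
Qed.

Lemma tops0 n y q a : (forall u, u < n -> a \notin q u) ->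
  (forall u, u < n -> exists2 b, b \in q u & b \notin y) -> tops n y q a = 0.
Proof.
move=> aq yq; apply/eqP; rewrite -leqn0 leqNgt -has_count; apply/hasPn => u.
rewrite mem_iota => /= un; have [b bq b_y] := yq u un.
by apply/negP => /eqP /(top_mem bq b_y); apply/negP/aq.
Qed.

Lemma tops_le1 n y (f : nat -> nat) a b : injective f -> a != b -> b \notin y ->
  tops n y (fun u => [:: f u; b]) a <= 1.
Proof.
move=> f_inj ab b_y; apply: (@leq_trans (count (pred1 a) (map f (iota 0 n)))); last first.
  by rewrite count_uniq_mem ?map_inj_uniq ?iota_uniq // leq_b1.
rewrite count_map; apply: sub_count => u /=; rewrite !top_cons (negbTE b_y).
by case: ifP => _ // E; case/negP: ab; rewrite eq_sym.
Qed.

(** By the relation between [out1] and [out2] both rivals end with exactly [m * (2 + out2) + k]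
    points, which p exceeds since at least [k] sets are covered. All other candidates stay within
    [2 * m], below the score of p. *)
Lemma winner_of_bound n y sets k : all (all (fun u => u < n)) sets ->
  n.*2 \notin y -> n.*2 + 1 \notin y -> n.*2 + 2 \notin y ->
  k <= count (covered y) sets -> out1 n y = (out2 n y).+1 ->
  unique_plurality_winner (ccdc_of_mku (MkMkU n sets k)) y.
Proof.
move=> lt_sets wy zy py cov_k Eout.
have tw : top n y [:: n.*2] = Some n.*2 by rewrite top_cons (negbTE wy).
have tz : top n y [:: n.*2 + 1] = Some (n.*2 + 1) by rewrite top_cons (negbTE zy).
have tp : top n y [:: n.*2 + 2] = Some (n.*2 + 2) by rewrite top_cons (negbTE py).
have ne2 : Some n.*2 != Some (n.*2 + 2) by apply/eqP => -[]; clear; lia.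
have ne1 : Some (n.*2 + 1) != Some (n.*2 + 2) by apply/eqP => -[]; clear; lia.
have := @score_p n y py sets k lt_sets; rewrite tw tz => /(_ ne2 ne1) Sp.
rewrite /unique_plurality_winner; apply/allP => a; rewrite mem_iota add0n => /= ac.
case: (boolP (a \in y)) => //= ay; case: eqP => //= /eqP ap; rewrite {}Sp (score_eq py) tw tz tp.
have nap : (Some (n.*2 + 2) == Some a) = false by apply/negbTE; rewrite eq_sym.
have sets0 : n <= a -> count (fun s => top n y (rcons s (n.*2 + 2)) == Some a) sets = 0.
  move=> na; apply/eqP; rewrite -leqn0 leqNgt -has_count; apply/hasPn => s ss.
  apply/negP => /eqP H; have ps : n.*2 + 2 \in rcons s (n.*2 + 2) by rewrite mem_rcons mem_head.
  have := top_mem ps py H; rewrite mem_rcons inE (negbTE ap) => /(allP (allP lt_sets _ ss)).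
  by rewrite ltnNge na.
have z2 : n <= a -> tops n y (fun u => [:: u; n.*2 + 1]) a = (a == n.*2 + 1) * out1 n y.
  move=> na; case: (a =P n.*2 + 1) => [->|/eqP az]; rewrite ?mul1n ?mul0n.
    apply: eq_in_count => u; rewrite mem_iota => /= un; rewrite !top_cons (negbTE zy).
    case: (u \in y); rewrite ?eqxx //; apply/eqP => -[]; clear - un; lia.
  apply: tops0 => u un; first by rewrite !inE (negbTE az) orbF; apply/eqP; clear - un na; lia.
  by exists (n.*2 + 1) => //; rewrite !inE eqxx orbT.
set S1 := count _ sets in sets0 *.
have S1m : S1 <= size sets by apply: count_size.
set t1 := tops n y _ a in z2 *; set t2 := tops n y _ a; set t3 := tops n y _ a.
rewrite nap; move: cov_k ap; set cov := count _ sets => cov_k ap.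
have E2 : t2 <= 1 by apply: tops_le1 => //; exact: addnI.
(* A remaining element heads at most one vote per set and its own vote against z in each block. *)
have [an|na] := ltnP a n.
  have Z2 : t2 = 0.
    apply: tops0 => u un; first by rewrite !inE; clear - an; lia.
    by exists (n.*2 + 2) => //; rewrite !inE eqxx orbT.
  have Z3 : t3 = 0.
    apply: tops0 => u un; first by rewrite !inE; clear - an; lia.
    by exists n.*2 => //; rewrite !inE eqxx orbT.
  have Z1 : t1 <= 1.
    by apply: (@tops_le1 n y id) => //; apply/eqP; clear - an; lia.
  have -> : (Some n.*2 == Some a) = false by apply/eqP => -[]; clear - an; lia.
  have -> : (Some (n.*2 + 1) == Some a) = false by apply/eqP => -[]; clear - an; lia.
  have := leq_mul (leqnn (size sets)) Z1; rewrite Z2 Z3 /=.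
  by clear - S1m; rewrite !mulnDr; lia.
rewrite sets0 // z2 //.
have [aw|aw] := eqVneq a n.*2.
  have -> : (Some n.*2 == Some a) by rewrite aw.
  have -> : (Some (n.*2 + 1) == Some a) = false by apply/eqP => -[]; clear - aw; lia.
  have -> : (a == n.*2 + 1) = false by apply/eqP; clear - aw; lia.
  have Z2 : t2 = 0.
    apply: tops0 => u un; first by rewrite !inE; clear - aw un; lia.
    by exists (n.*2 + 2) => //; rewrite !inE eqxx orbT.
  have Z3 : t3 = out2 n y.
    apply: eq_in_count => u; rewrite mem_iota => /= un; rewrite !top_cons (negbTE wy).
    case: (_ \in y); first by rewrite aw eqxx.
    by apply/eqP => -[]; clear - aw un; lia.
  by rewrite Z2 Z3 /=; clear - cov_k; rewrite !mulnDr; lia.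
have -> : (Some n.*2 == Some a) = false by apply/negbTE; rewrite eq_sym.
have Z3 : t3 <= 1 by apply: tops_le1 => //; exact: addnI.
have [az|az] := eqVneq a (n.*2 + 1).
  have Z2 : t2 = 0.
    apply: tops0 => u un; first by rewrite !inE; clear - az un; lia.
    by exists (n.*2 + 2) => //; rewrite !inE eqxx orbT.
  have {}Z3 : t3 = 0.
    apply: tops0 => u un; first by rewrite !inE; clear - az un; lia.
    by exists n.*2 => //; rewrite !inE eqxx orbT.
  have -> : (Some (n.*2 + 1) == Some a) by rewrite az.
  by rewrite Z2 Z3 Eout /=; clear - cov_k; rewrite !mulnDr; lia.
have -> : (Some (n.*2 + 1) == Some a) = false by apply/negbTE; rewrite eq_sym.
(* What is left is a partner, which heads at most its two own votes in each block. *)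
have := leq_mul (leqnn (size sets)) E2; have := leq_mul (leqnn (size sets)) Z3; rewrite /=.
by clear; rewrite !mulnDr; lia.
Qed.

Lemma mku_feasible_measure_gt0 x y : mku_valid x -> 0 < mku_k x -> mku_feasible x y ->
  0 < mku_measure x y.
Proof.
case: x => n sets k /and4P[_ /= valid _ _] k0 /and3P[_ /= ym /eqP Ek].
case: y ym Ek => [|i y] /=; first by move=> _ E; rewrite -E in k0.
move=> /andP[lt_i _] _; have /and3P[s0 _ _] := allP valid _ (mem_nth [::] lt_i).
rewrite /mku_measure /=; case: (nth [::] sets i) s0 => // u s _.
have : u \in undup ((u :: s) ++ flatten [seq nth [::] sets i | i <- y]).
  by rewrite mem_undup mem_head.
by case: (undup _).
Qed.

Lemma ccdc_of_union x y0 : mku_valid x -> 0 < mku_k x -> mku_feasible x y0 ->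
  exists y, ccdc_feasible (ccdc_of_mku x) y /\ (size y).+1 <= 2 * mku_measure x y0.
Proof.
case: x => n sets k vx /= k0 fy0; have /and3P[uy0 /= y0m /eqP Ek] := fy0.
have lt_sets := all_lt_sets vx; have /and4P[_ /= valid uS km] := vx.
pose T := undup (flatten [seq nth [::] sets i | i <- y0]).
have Tn u : u \in T -> u < n.
  rewrite mem_undup => /flattenP[s /mapP[i iy ->] us].
  have lt_i := allP y0m _ iy.
  exact: (allP (allP lt_sets _ (mem_nth [::] lt_i))).
have T0 : 0 < size T := mku_feasible_measure_gt0 vx k0 fy0.
have Tsize : size T <= n.
  rewrite -[n](size_iota 0); apply: uniq_leq_size; first exact: undup_uniq.
  by move=> u /Tn; rewrite mem_iota.
(* Only the number of deleted partners matters, so the first ones are taken; there are enough of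
   them because [T] has at most [n] elements. *)
pose y := T ++ iota n (size T).-1; exists y.
have yE a : (a \in y) = (a \in T) || (n <= a < n + (size T).-1) by rewrite mem_cat mem_iota.
have yn a : a < n -> (a \in y) = (a \in T) by move=> an; rewrite yE [n <= a]leqNgt an orbF.
have ynot a : n.*2 <= a -> a \notin y.
  move=> na; rewrite yE negb_or; apply/andP; split; last by lia.
  by apply/negP => /Tn; lia.
have sy : (size y).+1 <= 2 * size T by rewrite size_cat size_iota; lia.
split=> //; have py : n.*2 + 2 \notin y by apply: ynot; lia.
apply/and4P; split=> //=.
- rewrite cat_uniq undup_uniq iota_uniq andbT /=; apply/hasPn => u; rewrite mem_iota => nu.
  by apply/negP => /Tn; lia.
- apply/allP => a; rewrite yE => /orP[/Tn|]; lia.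
apply: winner_of_bound => //.
- exact: ynot.
- by apply: ynot; rewrite leq_addr.
- rewrite -Ek -[in leqRHS](mkseq_nth [::] sets) count_map -size_filter; apply: uniq_leq_size => // i iy.
  have lt_i := allP y0m _ iy; rewrite mem_filter mem_iota /= add0n lt_i andbT; apply/allP => u us.
  rewrite yE mem_undup; apply/orP; left; apply/flattenP; exists (nth [::] sets i) => //.
  exact: map_f.
have o1 : out1 n y = size T.
  rewrite /out1 -size_filter; apply/perm_size/uniq_perm; rewrite ?filter_uniq ?iota_uniq
      ?undup_uniq // => u.
  rewrite mem_filter mem_iota /=; case: (ltnP u n) => nu; first by rewrite yn ?andbT.
  by rewrite andbF; apply/esym/negP => /Tn; lia.
have o2 : out2 n y = (size T).-1.
  rewrite /out2 -size_filter -[RHS](size_iota 0); apply/perm_size/uniq_perm.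
  - by rewrite filter_uniq ?iota_uniq.
  - exact: iota_uniq.
  - move=> u; rewrite mem_filter !mem_iota yE !add0n /=.
    have -> : (n + u \in T) = false by apply/negP => /Tn; lia.
    rewrite /= leq_addr ltn_add2l /=; case: (ltnP u (size T).-1) => //= lt_u.
    exact: leq_trans lt_u (leq_trans (leq_pred _) Tsize).
by rewrite o1 o2 prednK.
Qed.


(** * Performance ratios and the strict reduction *)

Import Order.TTheory Num.Theory.

(** On the left [o <= a] makes the first quotient the maximum, and on the right the maximum is at
    least the first quotient, so comparing first quotients suffices. *)
Lemma perf_ratio_le (a o b oB : nat) : 0 < o -> o <= a -> 0 < oB -> a * oB <= b * o ->
  (perf_ratio a o <= perf_ratio b oB)%R.
Proof.
move=> o0 oa oB0 le_ab; have a0 := leq_trans o0 oa; rewrite /perf_ratio.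
have o0R : (0 < o%:R :> rat)%R by rewrite ltr0n.
have a0R : (0 < a%:R :> rat)%R by rewrite ltr0n.
have oB0R : (0 < oB%:R :> rat)%R by rewrite ltr0n.
rewrite (@max_l _ _ (a%:R / o%:R)%R (o%:R / a%:R)%R); last first.
  rewrite ler_pdivrMr // mulrAC ler_pdivlMr // -!natrM ler_nat.
  exact: leq_mul.
rewrite le_max; apply/orP; left; rewrite ler_pdivrMr // mulrAC ler_pdivlMr //.
by rewrite -!natrM ler_nat.
Qed.

Lemma perf_ratio00 : perf_ratio 0 0 = 0%R.
Proof. by rewrite /perf_ratio mul0r maxxx. Qed.

Lemma perf_ratio_ge0 a o : (0 <= perf_ratio a o)%R.
Proof. by rewrite /perf_ratio le_max divr_ge0 ?ler0n. Qed.

Theorem theorem3 : mku_strictly_reduces_to_ccdc.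
Proof.
exists ccdc_of_mku, choose_sets; split.
- exact: ptime_reduce.
- by apply: ptime_solve => xy [].
- move=> x vx; rewrite /ccdc_valid /= ltn_add2l /=; apply/allP => _ /mapP[q qx ->].
  have /andP[uq qc] := allP (okp_prefixes vx) _ qx.
  exact: perm_vote.
- by move=> x y vx _; apply: mku_feasible_choose.
move=> x y oA oB vx fy [[yA [fA EA]] minA] [[yB [fB EB]] minB].
have fC := mku_feasible_choose y vx.
(* For [k = 0] the only solution is the empty family, of measure 0, and the ratio is [0 / 0], which
   is 0 in [rat]. The gadget bounds need [0 < k], so this case is separate. *)
case: (posnP (mku_k x)) => [k0|k_gt0].
  have measure0 y0 : mku_feasible x y0 -> mku_measure x y0 = 0.
    by move=> /and3P[_ _]; rewrite k0 => /nilP->.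
  by rewrite measure0 // -EA measure0 // perf_ratio00 perf_ratio_ge0.
have oA0 : 0 < oA by rewrite -EA mku_feasible_measure_gt0.
have [yH [fH leH]] := ccdc_of_union vx k_gt0 fA.
have le_oB : oB <= 2 * oA by rewrite -EA; apply: leq_trans leH; apply: minB.
have le_y := choose_measure vx k_gt0 fy.
apply: perf_ratio_le => //; first exact: minA.
  by rewrite -EB.
(* The factor 2 is moved from the optimum of the image to the measure of the chosen sets, where
   [choose_measure] absorbs it. *)
apply: (@leq_trans (mku_measure x (choose_sets x y) * (2 * oA))).
  by rewrite leq_mul2l le_oB orbT.
by rewrite mulnA [_ * 2]mulnC leq_mul2r le_y orbT.
Qed.
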